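(* Fix integers $n\ge 3$ and $k\ge 1$, let $K$ be a field containing $n$ distinct $n$-th roots of $1$, let $R=K[x,y,z]$, and put $f=y^n-z^n$, $g=z^n-x^n$, $h=x^n-y^n$. Define recursively matrices $\mathbf{X}_j$ over $R$ of size $(k(n-3)+jn+1)\times(k(n-3)+jn)$, for $0\le j\le 3k$, as follows. Put $\mathbf{X}_0=H(f,g)_{k(n-3)}$. For $j\ge 1$ write $j=3i+r$ with integers $i\ge 0$ and $1\le r\le 3$, and put $$\mathbf{X}_j=\begin{bmatrix}\mathbf{X}_{j-1}&Y_j\\ 0&Z_j\end{bmatrix},\qquad Z_j=\begin{cases}C(x,y)_n&\text{if } r=1\\ C(y,z)_n&\text{if } r=2\\ C(z,x)_n&\text{if } r=3\end{cases},\qquad Y_j=\begin{bmatrix}S_j&0\\ 0&0\end{bmatrix},$$ where $Y_j$ has $n$ columns and $S_j$ is a column vector occupying the top entries of the first column of $Y_j$. The vectors $S_1,S_2,S_3$ have $k(n-3)+1$ entries and are $$S_1=(-1)^{k(n-3)}xf\,e_{n-2},\quad S_2=\begin{bmatrix}0\\ (-1)^{(k-1)(n-3)}yg\,E_{n-3}\end{bmatrix},\quad S_3=\begin{bmatrix}(-1)^{n-3}zh\,E_{(k-1)(n-3)}\\ 0\end{bmatrix}.$$ For $4\le j\le 3k$, $S_j$ is a column vector with $k(n-3)+(j-3)n+1$ homogeneous entries (as specified in the context) such that $$\det\begin{bmatrix}\mathbf{X}_{j-3}&S_j\end{bmatrix}=\begin{cases}f^{(k-1-i)(n-3)+2i}g^{(i+1)(n-2)-2}x^{in+1}&\text{if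 } r=1\\ g^{(k-1-i)(n-3)+2i}h^{(i+1)(n-2)-1}y^{in+1}&\text{if } r=2\\ f^{(i+1)(n-2)-1}h^{(k-1-i)(n-3)+2i+1}z^{in+1}&\text{if } r=3.\end{cases}$$ Such column vectors $S_j$ exist. Moreover, denoting by $I(\mathbf{X}_j)$ the ideal of maximal minors of $\mathbf{X}_j$, for every $1\le j\le 3k$, written as $j=3i+r$ with integers $i\ge 0$ and $1\le r\le 3$: (1) $$I(\mathbf{X}_j)=\begin{cases}h\cdot I(\mathbf{X}_{j-1})+f^{(k-1-i)(n-3)+2i+1}g^{(i+1)(n-2)-1}x^{in+1}\cdot(x,y)^{n-1}&\text{if } r=1\\ f\cdot I(\mathbf{X}_{j-1})+g^{(k-1-i)(n-3)+2i+1}h^{(i+1)(n-2)}y^{in+1}\cdot(y,z)^{n-1}&\text{if } r=2\\ g\cdot I(\mathbf{X}_{j-1})+f^{(i+1)(n-2)}h^{(k-1-i)(n-3)+2i+2}z^{in+1}\cdot(x,z)^{n-1}&\text{if } r=3.\end{cases}$$ (2) A minimal graded free resolution of $I(\mathbf{X}_j)$ is $$0\to F_1\xrightarrow{\ \mathbf{X}_j\ }F_0\to I(\mathbf{X}_j)\to 0,$$ where $$F_1=R(-n[k(n-3)+j+1])^{k(n-3)}\oplus\bigoplus_{\ell=1}^{i}R(-n[k(n-3)+j+\ell]-1)^{3n}\oplus R(-n[k(n-3)+j+i+1]-1)^{rn},$$ $$F_0=R(-n[k(n-3)+j])^{k(n-3)+1}\oplus\bigoplus_{\ell=1}^{i}R(-n[k(n-3)+j+\ell])^{3n}\oplus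 R(-n[k(n-3)+j+i+1])^{rn}.$$ (3) $$I(\mathbf{X}_j)=\begin{cases}(f,g)^{k(n-3)+j}\cap(x,y)^{(i+1)n}\cap(y,z)^{in}\cap(x,z)^{in}&\text{if } r=1\\ (f,g)^{k(n-3)+j}\cap(x,y)^{(i+1)n}\cap(y,z)^{(i+1)n}\cap(x,z)^{in}&\text{if } r=2\\ (f,g)^{k(n-3)+j}\cap(x,y)^{(i+1)n}\cap(y,z)^{(i+1)n}\cap(x,z)^{(i+1)n}&\text{if } r=3.\end{cases}$$
   Context: Notation. For elements $a,b$ of a commutative ring and an integer $t\ge 0$: $H(a,b)_t$ is the $(t+1)\times t$ matrix whose $(p,p)$ entry is $-b$ and whose $(p+1,p)$ entry is $a$ for $1\le p\le t$, all other entries being $0$ (for $t=0$ it is the empty $1\times 0$ matrix, whose ideal of maximal minors is the unit ideal). For $t\ge 2$, $C(a,b)_t$ is the $t\times t$ matrix with diagonal entries $a$, entries $-b$ in positions $(p,p+1)$ for $1\le p\le t-1$, entry $-b$ in position $(t,1)$, and zeros elsewhere (for $t=2$: $\begin{bmatrix}a&-b\\ -b&a\end{bmatrix}$). $E_j$ is the column vector with $j+1$ entries $\binom j0,\binom j1,\dots,\binom jj$. $e_j$ is the $j$-th standard basis column vector (here of length $k(n-3)+1$). The zeros in block vectors and matrices denote zero blocks of the size needed to fill up the stated total size. An ideal raised to the power $0$ is $R$. Homogeneity of $S_j$ for $j\ge 4$: the $p$-th entry of $S_j$ is zero or homogeneous of degree equal to the degree of the prescribed determinant minus the degree of the maximal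 minor of $\mathbf{X}_{j-3}$ obtained by deleting row $p$ (so that $\mathbf{X}_j$ is the matrix of a graded map). *)

(* Defs.v *)
From HB Require Import structures.
From mathcomp Require Export all_boot all_order all_algebra.
From mathcomp.multinomials Require Export mpoly.

Set Implicit Arguments.
Unset Strict Implicit.
Unset Printing Implicit Defensive.

Import GRing.Theory.
Local Open Scope ring_scope.

(* Ideals are Prop-valued predicates, compared extensionally by [idl_eq]:
   the [idealr] of ring_quotient are decidable and proper, which excludes the
   unit ideal. *)
Section Ideals.
Variable A : comNzRingType.
Implicit Types (I J : A -> Prop) (a : A).

Definition idl_eq I J : Prop := forall a, I a <-> J a.

Definition idl_gen (m : nat) (u : 'I_m -> A) : A -> Prop :=
  fun a => exists c : 'I_m -> A, a = \sum_(i < m) c i * u i.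

Definition idl_seq (s : seq A) : A -> Prop :=
  idl_gen (fun i : 'I_(size s) => s`_i).

Definition idl_add I J : A -> Prop :=
  fun a => exists b c, [/\ I b, J c & a = b + c].

Definition idl_scale (d : A) I : A -> Prop :=
  fun a => exists2 b, I b & a = d * b.

Definition idl_cap I J : A -> Prop := fun a => I a /\ J a.

Definition idl_mul I J : A -> Prop :=
  fun a => exists2 s : seq (A * A),
    (forall u, u \in s -> I u.1 /\ J u.2) & a = \sum_(u <- s) u.1 * u.2.

Definition idl_exp I (m : nat) : A -> Prop :=
  iter m (idl_mul I) (fun _ => True).

Definition idl_minors (m : nat) (M : 'M[A]_(m.+1, m)) : A -> Prop :=
  idl_gen (fun p : 'I_m.+1 => \det (row' p M)).

End Ideals.

Section Matrices.
Variable A : comNzRingType.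

Definition Hmx (a b : A) (t : nat) : 'M[A]_(t.+1, t) :=
  \matrix_(p, q) if p == q :> nat then - b
                 else if p == q.+1 :> nat then a else 0.

Definition Cmx (a b : A) (t : nat) : 'M[A]_t :=
  \matrix_(p, q) if p == q then a
                 else if q == p.+1 :> nat then - b
                 else if (p.+1 == t) && (q == 0 :> nat) then - b else 0.

Definition Ecol (j : nat) : 'cV[A]_j.+1 := \col_p ('C(j, p))%:R.

(* [v; 0] and [0; v], filled up with zeros to length m *)
Definition pad_top (m l : nat) (v : 'cV[A]_l) : 'cV[A]_m :=
  \col_p if insub (p : nat) is Some q then v q 0 else 0.

Definition pad_bot (m l : nat) (v : 'cV[A]_l) : 'cV[A]_m :=
  \col_p if (m - l <= p)%N then
           if insub (p - (m - l))%N is Some q then v q 0 else 0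
         else 0.

(* [v 0; 0 0] of size m * n *)
Definition pad_corner (m n l : nat) (v : 'cV[A]_l) : 'M[A]_(m, n) :=
  \matrix_(p, q) if q == 0 :> nat then pad_top m v p 0 else 0.

Definition det_adjoin (m : nat) (M : 'M[A]_(m.+1, m)) (s : 'cV[A]_m.+1) : A :=
  \det (castmx (erefl m.+1, addn1 m) (row_mx M s)).

End Matrices.

Definition by3 (T : Type) (r : nat) (a1 a2 a3 : T) : T :=
  match r with 1 => a1 | 2 => a2 | _ => a3 end.

(* j = 3i + r with 1 <= r <= 3, for j >= 1 *)
Definition quo3 (j : nat) : nat := (j.-1 %/ 3)%N.
Definition rem3 (j : nat) : nat := (j.-1 %% 3)%N.+1.

Lemma quo3_rem3 (i r : nat) : (0 < r <= 3)%N ->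
  quo3 (3 * i + r)%N = i /\ rem3 (3 * i + r)%N = r.
Proof.
case: r => [//|r]; rewrite ltnS => /andP[_ r3].
by rewrite /quo3 /rem3 addnS /= mulnC divnMDl // modnMDl divn_small // addn0
  modn_small.
Qed.

Section GradedResolutions.
Variable K : fieldType.
Local Notation R := {mpoly K[3]}.

Definition px : R := 'X_(@Ordinal 3 0 isT).
Definition py : R := 'X_(@Ordinal 3 1 isT).
Definition pz : R := 'X_(@Ordinal 3 2 isT).

(* total degree (of a nonzero polynomial) *)
Definition tdeg (p : R) : nat := (msize p).-1.

(* The list of naturals [:: d_1; ...; d_m] encodes the graded free module
   R(-d_1) (+) ... (+) R(-d_m).  M is the matrix of a graded map (of degree 0)
   from the module encoded by b to the one encoded by a. *)
Definition graded_mx (a b : seq nat) (m t : nat) (M : 'M[R]_(m, t)) : Prop :=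
  forall p q, M p q = 0 \/
    exists2 e, (nth 0 a p + e = nth 0 b q)%N & M p q \is e.-homog.

(* 0 -> F_1 --M--> F_0 --eps--> I -> 0 is a minimal graded free resolution for
   some eps, where F_1, F_0 are encoded by b, a. *)
Definition min_graded_free_res (b a : seq nat) (m t : nat) (M : 'M[R]_(m, t))
    (I : R -> Prop) : Prop :=
  [/\ size b = t, size a = m, graded_mx a b M,
      (forall p q, idl_seq [:: px; py; pz] (M p q))
    & exists eps : 'rV[R]_m,
      [/\ graded_mx [:: 0%N] a eps,
          (forall v : 'cV[R]_t, M *m v = 0 -> v = 0),
          (forall u : 'cV[R]_m, eps *m u = 0 <-> exists v, u = M *m v)
        & (forall c : R, I c <-> exists u : 'cV[R]_m, c = (eps *m u) 0 0)]].

End GradedResolutions.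

Section Construction.
Variables (K : fieldType) (n k : nat).
Local Notation R := {mpoly K[3]}.
Local Notation x := (px K).
Local Notation y := (py K).
Local Notation z := (pz K).

Definition pf : R := y ^+ n - z ^+ n.
Definition pg : R := z ^+ n - x ^+ n.
Definition ph : R := x ^+ n - y ^+ n.

(* Number of columns of X_j; defined by recursion so that the block matrix
   below is well typed without casts. *)
Fixpoint Xdim (j : nat) : nat :=
  if j is j'.+1 then (Xdim j' + n)%N else (k * (n - 3))%N.

Lemma XdimE j : Xdim j = (k * (n - 3) + j * n)%N.
Proof. by elim: j => [|j IH] /=; rewrite ?addn0 // IH mulSnr addnA. Qed.

(* By truncated subtraction j - 3 = 0 for j <= 3, so that S_1, S_2, S_3 have
   k(n-3)+1 entries. *)
Definition Sfamily : Type := forall j : nat, 'cV[R]_(Xdim (j - 3)).+1.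

Definition Zmx (j : nat) : 'M[R]_n :=
  by3 (rem3 j) (Cmx x y n) (Cmx y z n) (Cmx z x n).

Fixpoint Xmx (S : Sfamily) (j : nat) : 'M[R]_((Xdim j).+1, Xdim j) :=
  match j return 'M[R]_((Xdim j).+1, Xdim j) with
  | 0 => Hmx pf pg (k * (n - 3))
  | j'.+1 => block_mx (Xmx S j') (pad_corner (Xdim j').+1 n (S j'.+1))
                      0 (Zmx j'.+1)
  end.

(* e_{n-2} has its entry 1 at the 0-based position n-3 *)
Definition S1 : 'cV[R]_(k * (n - 3)).+1 :=
  ((-1) ^+ (k * (n - 3)) * x * pf) *: \col_p (p == (n - 3)%N :> nat)%:R.

Definition S2 : 'cV[R]_(k * (n - 3)).+1 :=
  pad_bot _ (((-1) ^+ ((k - 1) * (n - 3)) * y * pg) *: Ecol R (n - 3)).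

Definition S3 : 'cV[R]_(k * (n - 3)).+1 :=
  pad_top _ (((-1) ^+ (n - 3) * z * ph) *: Ecol R ((k - 1) * (n - 3))).

Definition prescribed_det (i r : nat) : R :=
  by3 r
    (pf ^+ ((k - 1 - i) * (n - 3) + 2 * i) * pg ^+ ((i + 1) * (n - 2) - 2)
       * x ^+ (i * n + 1))
    (pg ^+ ((k - 1 - i) * (n - 3) + 2 * i) * ph ^+ ((i + 1) * (n - 2) - 1)
       * y ^+ (i * n + 1))
    (pf ^+ ((i + 1) * (n - 2) - 1) * ph ^+ ((k - 1 - i) * (n - 3) + 2 * i + 1)
       * z ^+ (i * n + 1)).

(* s is an allowed choice of S_j (for j >= 4), given S_1, ..., S_{j-3} *)
Definition S_allowed (S : Sfamily) (j : nat)
    (s : 'cV[R]_(Xdim (j - 3)).+1) : Prop :=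
  (forall p, s p 0 = 0 \/
     exists2 e, (tdeg (\det (row' p (Xmx S (j - 3)))) + e
                 = tdeg (prescribed_det (quo3 j) (rem3 j)))%N & s p 0 \is e.-homog)
  /\ det_adjoin (Xmx S (j - 3)) s = prescribed_det (quo3 j) (rem3 j).

Arguments S_allowed : clear implicits.

(* S_1, ..., S_m are as prescribed (m >= 3) *)
Definition S_admissible (m : nat) (S : Sfamily) : Prop :=
  [/\ S 1%N = S1, S 2%N = S2, S 3%N = S3
    & forall j, (4 <= j <= m)%N -> S_allowed S j (S j)].

(* The summands are listed in the order of the blocks of X_j: first the columns
   (rows) of X_0, then those of Z_1, ..., Z_j. *)
Definition F1shifts (j i r : nat) : seq nat :=
  nseq (k * (n - 3)) (n * (k * (n - 3) + j + 1))%N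
  ++ flatten [seq nseq (3 * n) (n * (k * (n - 3) + j + l) + 1)%N
             | l <- iota 1 i]
  ++ nseq (r * n) (n * (k * (n - 3) + j + i + 1) + 1)%N.

Definition F0shifts (j i r : nat) : seq nat :=
  nseq (k * (n - 3) + 1) (n * (k * (n - 3) + j))%N
  ++ flatten [seq nseq (3 * n) (n * (k * (n - 3) + j + l))%N | l <- iota 1 i]
  ++ nseq (r * n) (n * (k * (n - 3) + j + i + 1))%N.

End Construction.

#[global] Arguments S_allowed {K n k} S j s.

(* Main.v *)
Require Import Defs.
From HB Require Import structures.
From mathcomp Require Import ring zify.

(* Each X_j arises from M = X_(j-1) by adjoining the block Z = C(a,b)_n, where
   (a,b,c) is a rotation of (x,y,z) and det Z = d = a^n - b^n.  The row of signed
   maximal minors of the new matrix is [d * minors(M), -F * (a^(n-1), ..., b^(n-1))],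
   where F = +-det[M S_j], because both rows annihilate the matrix and agree on
   the rows of M.  This gives (1), and F being regular modulo d makes the
   Hilbert-Burch complex of the new matrix exact as soon as that of M is.

   For (3), put e = c^n - a^n.  Modulo d the ideal (f,g)^(N+1) is generated by
   e^(N+1), and F is +-e^(N+1) a^(in+1).  An element u of the new intersection is
   e^(N+1) v modulo d; reducing b^n to a^n and comparing (a,b)-orders puts v in
   a^(in+1) (a,b)^(n-1) modulo d.  So u is in F (a,b)^(n-1) + d w, and d w lying in
   the new intersection forces w into the old one.

   The S_j exist because, by (3) for j - 3, the prescribed determinant lies in
   I(X_(j-3)); homogeneous components then give homogeneous entries. *)

(** Where the prescribed determinants come from: [S_j] has entries only in the rows of X_(j-3), and
    two blocks Z_(j-2), Z_(j-1) separate X_(j-3) from X_(j-1). Each of them multiplies the old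
    minors by its determinant, so F is, up to sign, the prescribed determinant times two of the
    forms f, g, h. The total exponent of the forms in F is then exactly N+1 = k(n-3)+j, as
    membership in (f,g)^(N+1) demands, while the separate exponents keep F in the powers of the two
    ideals that the step leaves unchanged. As f+g+h = 0, any two of the forms generate the same
    ideal, so (f,g)^N can be rewritten as (d,e)^N for every rotation. What is needed about K[x,y,z]
    is carried by two kinds of ring morphism into polynomials in one variable: a grading by the
    degree in two of the variables, which detects powers of the ideal they generate, and an
    expansion in one variable, which permits division by a^n - b^n. Stating the step for abstract
    coordinates of this kind makes one argument serve all three rotations. *)

Set Implicit Arguments.
Unset Strict Implicit.
Unset Printing Implicit Defensive.

Import GRing.Theory.
Local Open Scope ring_scope.

(** * Powers of two-generated ideals *)

Section IdealPowers.
Variable A : comNzRingType.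
Implicit Types (a b c d r : A) (I : A -> Prop).

Definition ideal_closed I : Prop :=
  [/\ I 0, forall b c, I b -> I c -> I (b + c) & forall r c, I c -> I (r * c)].

Lemma ideal_closed_sub I b c : ideal_closed I -> I b -> I c -> I (b - c).
Proof. by case=> _ ID IM Ib Ic; rewrite -mulN1r; apply/ID/IM. Qed.

Lemma idl_gen_closed m (u : 'I_m -> A) : ideal_closed (idl_gen u).
Proof.
split=> [|b c [v ->] [w ->]|r c [v ->]].
- by exists (fun=> 0); rewrite big1 // => i _; rewrite mul0r.
- by exists (fun i => v i + w i); rewrite -big_split; apply: eq_bigr => i _; rewrite mulrDl.
- by exists (fun i => r * v i); rewrite mulr_sumr; apply: eq_bigr => i _; rewrite mulrA.
Qed.

Lemma idl_gen_mem m (u : 'I_m -> A) i : idl_gen u (u i).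
Proof.
exists (fun j => (j == i)%:R); rewrite (bigD1 i) //= eqxx mul1r big1 ?addr0 //.
by move=> j /negPf ->; rewrite mul0r.
Qed.

Lemma idl_gen_min m (u : 'I_m -> A) I :
  ideal_closed I -> (forall i, I (u i)) -> forall c, idl_gen u c -> I c.
Proof.
case=> I0 ID IM Iu c [v ->].
by elim/big_ind: _ => // i _; apply: IM.
Qed.

(** The m-th power of the ideal (a,b), given by its monomial generators: with finitely many explicit
    generators, membership statements reduce to monomials through [idl_gen_min]. The link to
    [idl_exp] is [idl_exp_seq2]. *)
Definition pow2 a b m : A -> Prop :=
  idl_gen (fun q : 'I_m.+1 => a ^+ (m - q) * b ^+ q).

Lemma pow2_closed a b m : ideal_closed (pow2 a b m).
Proof. exact: idl_gen_closed. Qed.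

Lemma pow2_mulr a b m r c : pow2 a b m c -> pow2 a b m (r * c).
Proof. by case: (pow2_closed a b m) => _ _; apply. Qed.

Lemma pow2_mull a b m r c : pow2 a b m c -> pow2 a b m (c * r).
Proof. by rewrite mulrC; apply: pow2_mulr. Qed.

Lemma pow2_add a b m c d : pow2 a b m c -> pow2 a b m d -> pow2 a b m (c + d).
Proof. by case: (pow2_closed a b m) => _ + _; apply. Qed.

Lemma pow2_sub a b m c d : pow2 a b m c -> pow2 a b m d -> pow2 a b m (c - d).
Proof. by apply: ideal_closed_sub; apply: pow2_closed. Qed.

Lemma pow2_monomial a b m p q : (m <= p + q)%N -> pow2 a b m (a ^+ p * b ^+ q).
Proof.
move=> le_m; have [le_qm|lt_mq] := leqP q m.
  have lt_q : (q < m.+1)%N by [].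
  have -> : a ^+ p * b ^+ q = a ^+ (p - (m - q)) * (a ^+ (m - q) * b ^+ q).
    by rewrite mulrA -exprD subnK //; lia.
  apply: pow2_mulr.
  exact: (idl_gen_mem (fun q : 'I_m.+1 => a ^+ (m - q) * b ^+ q) (Ordinal lt_q)).
rewrite -(subnK (ltnW lt_mq)) exprD mulrA; apply: pow2_mulr.
by have := idl_gen_mem (fun q : 'I_m.+1 => a ^+ (m - q) * b ^+ q) ord_max;
   rewrite subnn mul1r.
Qed.

Lemma pow2_0 a b c : pow2 a b 0 c.
Proof.
rewrite -[c]mulr1; apply: pow2_mulr.
by have := @pow2_monomial a b 0 0 0 isT; rewrite mulr1.
Qed.

Lemma pow2_mul a b m m' c c' :
  pow2 a b m c -> pow2 a b m' c' -> pow2 a b (m + m') (c * c').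
Proof.
have [P0 PD PM] := pow2_closed a b (m + m').
move=> mc m'c'; move: c mc; apply: idl_gen_min => [|i].
  split=> [|c d|r c]; rewrite ?mul0r ?mulrDl //; first exact: PD.
  by rewrite -mulrA; apply: PM.
move: c' m'c'; apply: idl_gen_min => [|j].
  split=> [|c d|r c]; rewrite ?mulr0 ?mulrDr //; first exact: PD.
  by rewrite mulrCA; apply: PM.
rewrite mulrACA -!exprD; apply: pow2_monomial.
by have := ltn_ord i; have := ltn_ord j; lia.
Qed.

Lemma pow2_le a b m m' c : (m' <= m)%N -> pow2 a b m c -> pow2 a b m' c.
Proof.
move=> le_m; apply: idl_gen_min; first exact: pow2_closed.
by move=> i; apply: pow2_monomial; have := ltn_ord i; lia.
Qed.

Lemma pow2_exp a b m p c : pow2 a b m c -> pow2 a b (m * p) (c ^+ p).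
Proof.
move=> mc; elim: p => [|p IH]; first by rewrite muln0; apply: pow2_0.
by rewrite mulnS exprS; apply: pow2_mul.
Qed.

Lemma pow2_exp1 a b p c : pow2 a b 1 c -> pow2 a b p (c ^+ p).
Proof. by move/(pow2_exp p); rewrite mul1n. Qed.

Lemma pow2_change a b a' b' m c :
  pow2 a b 1 a' -> pow2 a b 1 b' -> pow2 a' b' m c -> pow2 a b m c.
Proof.
move=> Ha Hb; apply: idl_gen_min => [|i]; first exact: pow2_closed.
have : pow2 a b (1 * (m - i) + 1 * i) (a' ^+ (m - i) * b' ^+ i).
  by apply: pow2_mul; apply: pow2_exp.
by rewrite !mul1n subnK // -ltnS.
Qed.

Lemma pow2_memL a b : pow2 a b 1 a.
Proof. by have := @pow2_monomial a b 1 1 0 isT; rewrite mulr1. Qed.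

Lemma pow2_memR a b : pow2 a b 1 b.
Proof. by have := @pow2_monomial a b 1 0 1 isT; rewrite mul1r. Qed.

Lemma pow2C a b m c : pow2 a b m c -> pow2 b a m c.
Proof. exact/pow2_change/pow2_memL/pow2_memR. Qed.

Lemma idl_seq2 a b c : idl_seq [:: a; b] c <-> pow2 a b 1 c.
Proof.
split; (apply: idl_gen_min; first exact: idl_gen_closed).
  by case=> [[|[|//]] lti] /=; [apply: pow2_memL | apply: pow2_memR].
case=> [[|[|//]] lti] /=; rewrite ?mulr1 ?mul1r.
  exact: (idl_gen_mem (fun i : 'I_2 => [:: a; b]`_i) ord0).
exact: (idl_gen_mem (fun i : 'I_2 => [:: a; b]`_i) ord_max).
Qed.

Lemma idl_mul_closed I J : ideal_closed I -> ideal_closed (idl_mul I J).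
Proof.
case=> I0 ID IM; split=> [|b c [s sP ->] [s' s'P ->]|r c [s sP ->]].
- by exists [::]; rewrite ?big_nil.
- exists (s ++ s'); last by rewrite big_cat.
  by move=> u; rewrite mem_cat => /orP[/sP | /s'P].
- exists [seq (r * u.1, u.2) | u <- s].
    by move=> _ /mapP[u /sP[Iu Ju] ->] /=; split; [apply: IM|].
  by rewrite big_map mulr_sumr; apply: eq_bigr => u _; rewrite mulrA.
Qed.

Lemma idl_exp_seq2 a b m c : idl_exp (idl_seq [:: a; b]) m c <-> pow2 a b m c.
Proof.
elim: m c => [|m IH] c; first by split=> // _; apply: pow2_0.
split=> [[s sP ->]|].
  rewrite big_seq; have [P0 PD _] := pow2_closed a b m.+1.
  elim/big_ind: _ => // u /sP[/idl_seq2 u1 /IH u2].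
  by rewrite -(add1n m); apply: pow2_mul.
have prodI u v : pow2 a b 1 u -> pow2 a b m v ->
    idl_exp (idl_seq [:: a; b]) m.+1 (u * v).
  move=> /idl_seq2 Hu /IH Hv; exists [:: (u, v)]; rewrite ?big_seq1 // => w.
  by rewrite inE => /eqP ->.
apply: idl_gen_min => [|[q ltq] /=]; first exact/idl_mul_closed/idl_gen_closed.
case: q ltq => [|q] ltq.
  rewrite subn0 mulr1 exprS; apply: prodI (pow2_memL a b) _.
  by rewrite -[X in pow2 _ _ _ X]mulr1; apply: (@pow2_monomial a b m m 0); rewrite addn0.
rewrite subSS exprS mulrCA; apply: prodI (pow2_memR a b) _.
by apply: pow2_monomial; rewrite subnK // -2!ltnS.
Qed.

End IdealPowers.

(** * Signed maximal minors of block matrices *)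

Section SignedMinors.
Variable A : comNzRingType.

Definition sminors m (M : 'M[A]_(m.+1, m)) : 'rV[A]_m.+1 :=
  \row_p ((-1) ^+ p * \det (row' p M)).

Lemma det_adjoinE m (M : 'M[A]_(m.+1, m)) (s : 'cV[A]_m.+1) :
  det_adjoin M s = (-1) ^+ m * (sminors M *m s) 0 0.
Proof.
rewrite /det_adjoin (expand_det_col _ ord_max) !mxE mulr_sumr.
apply: eq_bigr => p _; rewrite castmxE /= cast_ord_id.
rewrite (_ : cast_ord _ ord_max = rshift m 0); last by apply: val_inj; rewrite /= addn0.
rewrite row_mxEr mxE /cofactor addnC exprD.
rewrite (_ : row' p _ = row' p M); first by ring.
apply/matrixP => i q; rewrite !mxE castmxE /= cast_ord_id.
rewrite (_ : cast_ord _ _ = lshift 1 q) ?row_mxEl //.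
by apply: val_inj; rewrite /= /bump leqNgt ltn_ord.
Qed.

(** Up to sign, entry q is the determinant of M with its own column q adjoined, a matrix with a
    repeated column. *)
Lemma sminors_mul m (M : 'M[A]_(m.+1, m)) : sminors M *m M = 0.
Proof.
apply/rowP => q; rewrite [RHS]mxE.
have -> : (sminors M *m M) 0 q = (sminors M *m col q M) 0 0.
  by rewrite !mxE; apply: eq_bigr => p _; rewrite !mxE.
have : det_adjoin M (col q M) = 0.
  rewrite /det_adjoin -det_tr.
  apply: (@determinant_alternate _ _ _ (cast_ord (addn1 m) (lshift 1 q))
                                       (cast_ord (addn1 m) (rshift m 0))).
    by rewrite (inj_eq (@cast_ord_inj _ _ _)) eq_lrshift.
  by move=> p; rewrite !mxE !castmxE /= !cast_ord_id !cast_ordK row_mxEl row_mxEr mxE.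
by rewrite det_adjoinE => /(congr1 ( *%R ((-1) ^+ m))); rewrite mulrA -expr2 sqrr_sign mul1r mulr0.
Qed.

Lemma idl_minorsE m (M : 'M[A]_(m.+1, m)) c :
  idl_minors M c <-> exists u : 'cV_m.+1, c = (sminors M *m u) 0 0.
Proof.
split=> [[w ->]|[u ->]].
  exists (\col_p ((-1) ^+ p * w p)); rewrite !mxE; apply: eq_bigr => p _.
  by rewrite !mxE mulrACA -expr2 sqrr_sign mul1r mulrC.
exists (fun p : 'I_m.+1 => (-1) ^+ p * u p 0); rewrite !mxE; apply: eq_bigr => p _.
by rewrite !mxE; ring.
Qed.

(* The 1 x m row of signed minors is the augmentation map of the Hilbert-Burch
   complex. *)
Definition hilbert_burch_exact m (M : 'M[A]_(m.+1, m)) : Prop :=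
  (forall v : 'cV_m, M *m v = 0 -> v = 0) /\
  (forall u : 'cV_m.+1, sminors M *m u = 0 -> exists v, u = M *m v).

End SignedMinors.

(** A padded column only sees the first l entries of the row. The main use is with the signed minors
    of X_j and X_l, where [c] is the product of the determinants of the blocks in between. *)
Lemma pad_topE (A : comNzRingType) m l (v : 'cV[A]_l) (lelm : (l <= m)%N)
    (e : 'rV[A]_m) (e' : 'rV[A]_l) c :
  (forall (p : 'I_m) (q : 'I_l), p = q :> nat -> e 0 p = c * e' 0 q) ->
  (e *m pad_top m v) 0 0 = c * (e' *m v) 0 0.
Proof.
move=> ee'; rewrite !mxE mulr_sumr.
rewrite [RHS](eq_bigr (fun q : 'I_l => e 0 (widen_ord lelm q) * pad_top m v (widen_ord lelm q) 0)).
  pose F p := if insub p is Some q then e 0 q * pad_top m v q 0 else 0.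
  rewrite (eq_bigr (fun p : 'I_m => F p)) => [|p _]; last by rewrite /F valK.
  rewrite [RHS](eq_bigr (fun p : 'I_l => F p)) => [|p _]; last first.
    by rewrite /F (insubT (fun i => (i < m)%N) (leq_trans (ltn_ord p) lelm)) /=;
       congr (e 0 _ * pad_top m v _ 0); apply: val_inj.
  rewrite (big_ord_widen_cond _ xpredT F lelm) big_mkcond /= [RHS]big_mkcond /=.
  apply: eq_bigr => p _; case: ltnP => // ge_p; rewrite /F valK mxE insubF ?mulr0 //.
  by rewrite ltnNge ge_p.
by move=> q _; rewrite mulrA (ee' _ q) // mxE /= valK.
Qed.

Lemma scalemx_eq0 (A : idomainType) m n (d : A) (v : 'M[A]_(m, n)) :
  d != 0 -> d *: v = 0 -> v = 0.
Proof.
move=> d0 /matrixP dv; apply/matrixP => i j; move/eqP: (dv i j).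
by rewrite !mxE mulf_eq0 (negPf d0) => /eqP.
Qed.

(** * Minors and exactness after adjoining a square block *)

Section BlockStep.
Variable A : idomainType.
Variables (m n : nat) (M : 'M[A]_(m.+1, m)) (s : 'cV[A]_m.+1) (Z : 'M[A]_n).
Variables (mu : 'rV[A]_n) (d : A).
Hypothesis muZ : mu *m Z = \row_q (if q == 0 :> nat then d else 0).
Hypothesis detZ : \det Z = d.
Hypothesis d_neq0 : d != 0.
Hypothesis n_gt0 : (0 < n)%N.

Let Y : 'M[A]_(m.+1, n) := \matrix_(p, q) if q == 0 :> nat then s p 0 else 0.
Let X : 'M[A]_((m + n).+1, m + n) := block_mx M Y 0 Z.
Let c := (sminors M *m s) 0 0.

(** Both rows are d c in the first column and 0 elsewhere, since [s] is the only nonzero column of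
    [Y] and mu Z is d times a unit row. *)
Lemma sminors_corner : d *: (sminors M *m Y) = c *: (mu *m Z).
Proof.
rewrite muZ; apply/rowP => q; rewrite !mxE; case: eqP => q0.
  rewrite [X in d * X](_ : _ = c); first exact: mulrC.
  by rewrite /c !mxE; apply: eq_bigr => p _; rewrite [Y _ _]mxE q0.
rewrite big1 ?mulr0 // => p _; rewrite [Y _ _]mxE.
by case: eqP q0; rewrite ?mulr0.
Qed.

Lemma mulZ_inj (v : 'cV[A]_n) : Z *m v = 0 -> v = 0.
Proof.
move=> Zv; apply: (scalemx_eq0 d_neq0).
by rewrite -detZ -mul_scalar_mx -mul_adj_mx -mulmxA Zv mulmx0.
Qed.

Lemma mulZ_injr (v : 'rV[A]_n) : v *m Z = 0 -> v = 0.
Proof.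
move=> Zv; apply: (scalemx_eq0 d_neq0).
by rewrite -detZ -mul_mx_scalar -mul_mx_adj mulmxA Zv mul0mx.
Qed.

(* Both sides lie in the left kernel of X and agree on the rows of M; a
   row vector (0, w) killed by X satisfies w Z = 0, hence vanishes. *)
Lemma sminors_block : sminors X = row_mx (d *: sminors M) (- c *: mu).
Proof.
pose E : 'rV[A]_(m.+1 + n) := row_mx (d *: sminors M) (- c *: mu).
have EX : E *m (X : 'M_(m.+1 + n, m + n)) = 0.
  rewrite /E /X mul_row_block mulmx0 addr0 -!scalemxAl sminors_mul scaler0.
  by rewrite sminors_corner scaleNr subrr row_mx0.
have up : lsubmx (sminors X : 'rV_(m.+1 + n)) = d *: sminors M.
  apply/rowP => p; rewrite !mxE /X /block_mx.
  rewrite (row'Ku p (row_mx M Y) (row_mx 0 Z)).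
  have -> : row' p (row_mx M Y) = row_mx (row' p M) (row' p Y).
    by apply/matrixP => i j; rewrite !mxE; case: split => k; rewrite !mxE.
  by rewrite (det_ublock (row' p M) (row' p Y) Z) detZ; ring.
have LX : (sminors X : 'rV_(m.+1 + n)) *m (X : 'M_(m.+1 + n, m + n)) = 0.
  exact: sminors_mul.
suff <- : rsubmx (sminors X : 'rV_(m.+1 + n)) = - c *: mu.
  by rewrite -up (hsubmxK (sminors X : 'rV_(m.+1 + n))).
move: LX up; move: (sminors X : 'rV_(m.+1 + n)) => L LX up.
have /mulZ_injr : (rsubmx L + c *: mu) *m Z = 0.
  have : (L - E) *m (X : 'M_(m.+1 + n, m + n)) = 0 by rewrite mulmxBl EX subr0.
  rewrite -[L in L - E]hsubmxK up /E opp_row_mx add_row_mx subrr scaleNr opprK.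
  rewrite /X mul_row_block !mul0mx !add0r => X0.
  by have := congr1 (@rsubmx _ _ m n) X0; rewrite row_mxKr linear0.
by move/eqP; rewrite addr_eq0 scaleNr => /eqP.
Qed.

Lemma idl_minors_block u :
  idl_minors X u <-> exists b (w : 'cV_n), idl_minors M b /\ u = d * b + c * (mu *m w) 0 0.
Proof.
rewrite idl_minorsE sminors_block; split=> [[v ->]|[b [w [/idl_minorsE[v ->] ->]]]].
  exists ((sminors M *m usubmx (v : 'cV_(m.+1 + n))) 0 0), (- dsubmx (v : 'cV_(m.+1 + n))).
  split; first by apply/idl_minorsE; eexists.
  rewrite -[v in LHS](@vsubmxK _ m.+1 n) (@mul_row_col _ _ m.+1 n) -!scalemxAl mulmxN.
  by rewrite !mxE; ring.
exists (col_mx v (- w)); rewrite (@mul_row_col _ _ m.+1 n) -!scalemxAl mulmxN.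
by rewrite !mxE; ring.
Qed.

(** For a kernel element (u1, u2), regularity of [c] modulo [d] makes mu u2 a multiple of [d]. A
    correction by a multiple of the first column of [Z] then brings u2 into the kernel of [mu], and
    what remains of u1 lies in the kernel for [M]. *)
Lemma hilbert_burch_block :
  (forall w : 'cV_n, mu *m w = 0 -> exists v, w = Z *m v) ->
  (forall a b, c * a = d * b -> exists b', a = d * b') ->
  hilbert_burch_exact M -> hilbert_burch_exact X.
Proof.
move=> mu_exact c_reg [M_inj M_exact]; split=> [v|u].
  rewrite -[v]vsubmxK /X (@mul_block_col _ m.+1 n m n) mul0mx add0r => Xv.
  have /mulZ_inj v2 : Z *m dsubmx v = 0.
    by have := congr1 (@dsubmx _ m.+1 n _) Xv; rewrite col_mxKd linear0.
  move: Xv; rewrite v2 !mulmx0 addr0 => Xv.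
  have := congr1 (@usubmx _ m.+1 n _) Xv.
  by rewrite col_mxKu linear0 => /M_inj ->; rewrite col_mx0.
rewrite sminors_block -[u](@vsubmxK _ m.+1 n).
set u1 := usubmx _; set u2 := dsubmx _; rewrite (@mul_row_col _ _ m.+1 n) -!scalemxAl => Eu.
have /c_reg[b mu_u2] : c * (mu *m u2) 0 0 = d * (sminors M *m u1) 0 0.
  have /eqP := congr1 (fun B : 'M_1 => B 0 0) Eu; rewrite !mxE.
  by rewrite mulNr subr_eq0 => /eqP.
have [v2 u2E] : exists v2, u2 = Z *m v2.
  (* Since mu Z is d times the first unit row, mu Z e = d b, which is the value of mu u2. *)
  pose e : 'cV[A]_n := \col_q (if q == 0 :> nat then b else 0).
  have /mu_exact[v] : mu *m (u2 - Z *m e) = 0.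
    rewrite mulmxBr mulmxA muZ; apply/eqP; rewrite subr_eq0; apply/eqP/rowP => i.
    rewrite ord1 mu_u2 mxE (bigD1 (Ordinal n_gt0)) //= !mxE eqxx big1 ?addr0 // => q q0.
    by rewrite !mxE (negPf (_ : q != 0 :> nat)) // mul0r.
  by move/eqP; rewrite subr_eq => /eqP ->; exists (v + e); rewrite mulmxDr.
have /M_exact[v1 u1E] : sminors M *m (u1 - Y *m v2) = 0.
  apply: (scalemx_eq0 d_neq0).
  rewrite mulmxBr scalerBr [sminors M *m (Y *m _)]mulmxA [d *: (_ *m v2)]scalemxAl sminors_corner.
  by rewrite -scalemxAl -mulmxA -u2E -scaleNr.
by exists (col_mx v1 v2); rewrite /X (@mul_block_col _ m.+1 n m n) mul0mx add0r -u2E -u1E addrNK.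
Qed.

End BlockStep.

(** * The matrices H(a,b) and C(a,b) *)

Section KoszulMatrices.
Variable A : idomainType.
Variables a b : A.
Hypotheses (a0 : a != 0) (b0 : b != 0).
Hypothesis ab_reg : forall v w, b * v = a * w -> exists v', v = a * v'.

Lemma regular_exp q v w : b ^+ q * v = a * w -> exists v', v = a * v'.
Proof.
elim: q v w => [|q IH] v w; first by rewrite mul1r; exists w.
by rewrite exprSr -mulrA => /IH[w' /ab_reg].
Qed.

(* The sequence v has v_0 = v_(t+1) = 0, so that the columns of both H(a,b)_t
   (shifting v by one) and C(a,b)_(t+1) (without its first column) occur. *)
Lemma monomial_syzygy t (u : nat -> A) :
  \sum_(q < t.+1) a ^+ (t - q) * b ^+ q * u q = 0 ->
  exists v : nat -> A, [/\ v 0%N = 0, v t.+1 = 0 &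
    forall q, (q <= t)%N -> u q = a * v q - b * v q.+1].
Proof.
elim: t u => [|t IH] u.
  rewrite big_ord1 !mul1r => u0; exists (fun=> 0); split=> // [[|//]] _.
  by rewrite u0 !mulr0 subr0.
rewrite big_ord_recr /= subnn mul1r.
under eq_bigr => q _ do rewrite subSn -1?ltnS // exprS -!mulrA.
rewrite -mulr_sumr => /eqP; rewrite addr_eq0 => /eqP Eu.
have /regular_exp[w uw] : b ^+ t.+1 * u t.+1 = a * - \sum_(q < t.+1) (a ^+ (t - q) * (b ^+ q * u q)).
  by rewrite mulrN Eu opprK.
(* The last coefficient is u_(t+1) = a w, so its term a w b^(t+1) can be moved to index t as b w,
   after which the whole relation is divisible by [a]. The relation at t yields v_t, and [w] serves
   as v_(t+1). *)
pose u' q := if q == t then u t + b * w else u q.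
have /IH[v [v0 vt vE]] : \sum_(q < t.+1) a ^+ (t - q) * b ^+ q * u' q = 0.
  apply: (mulfI a0); rewrite mulr0.
  have Ez : a * (\sum_(q < t.+1) (a ^+ (t - q) * (b ^+ q * u q))) + b ^+ t.+1 * (a * w) = 0.
    by rewrite -uw Eu addNr.
  rewrite -[RHS]Ez !big_ord_recr /= subnn /u' eqxx.
  rewrite (eq_bigr (fun q : 'I_t => a ^+ (t - q) * (b ^+ q * u q))) => [|q _].
    by rewrite exprS; ring.
  by rewrite ltn_eqF // mulrA.
exists (fun q => if q == t.+1 then w else if q == t.+2 then 0 else v q); split=> //=.
  by rewrite eqn_leq ltnn eqxx.
move=> q; rewrite leq_eqVlt => /predU1P[->|].
  by rewrite !eqxx [t.+2 == _]gtn_eqF // mulr0 subr0.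
rewrite ltnS => le_qt; rewrite !eqSS.
rewrite (ltn_eqF (_ : q < t.+1)%N) // (ltn_eqF (_ : q < t.+2)%N) ?ltnS ?leqW //.
have := vE q le_qt; rewrite /u'; have [->|ne_qt] := eqVneq q t.
  by rewrite vt mulr0 subr0 => <-; rewrite addrK.
by rewrite ?(negPf ne_qt).
Qed.

Lemma HmxE t (p : 'I_t.+1) (q : 'I_t) :
  Hmx a b t p q = a * (p == q.+1 :> nat)%:R - b * (p == q :> nat)%:R.
Proof.
rewrite mxE; have [->|_] := eqVneq (p : nat) q.
  by rewrite ltn_eqF // mulr0 mulr1 sub0r.
by case: eqP => _; rewrite ?mulr1 !mulr0 subr0.
Qed.

Lemma sum_delta t (p : nat) (F : nat -> A) :
  \sum_(q < t) (p == q)%:R * F q = if (p < t)%N then F p else 0.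
Proof.
rewrite (eq_bigr (fun q : 'I_t => if p == q then F q else 0)) => [|q _]; last first.
  by case: eqP => _; rewrite ?mul1r ?mul0r.
rewrite -big_mkcond /=; case: ifP => [lt_pt|/negP ge_pt].
  by rewrite (big_pred1 (Ordinal lt_pt)).
by rewrite big_pred0 // => q; apply/eqP => pq; apply: ge_pt; rewrite pq.
Qed.

Lemma Hmx_mulE t (v : 'cV[A]_t) (w : nat -> A) :
    w 0%N = 0 -> w t.+1 = 0 -> (forall q : 'I_t, w q.+1 = v q 0) ->
  forall p : 'I_t.+1, (Hmx a b t *m v) p 0 = a * w p - b * w p.+1.
Proof.
move=> w0 wt wE p; rewrite mxE.
have -> : \sum_j Hmx a b t p j * v j 0 =
    a * (\sum_(q < t) ((p : nat) == q.+1)%:R * w q.+1) - b * (\sum_(q < t) ((p : nat) == q)%:R * w q.+1).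
  by rewrite !mulr_sumr -sumrB; apply: eq_bigr => q _; rewrite HmxE wE; ring.
rewrite (sum_delta t p (fun q => w q.+1)).
have -> : \sum_(q < t) ((p : nat) == q.+1)%:R * w q.+1 = \sum_(q < t.+1) ((p : nat) == q)%:R * w q.
  by rewrite [RHS]big_ord_recl w0 mulr0 add0r; apply: eq_bigr.
rewrite (sum_delta t.+1) ltn_ord; congr (_ - b * _); case: ltnP => // le_tp.
by rewrite (_ : nat_of_ord p = t) //; apply/eqP; rewrite eqn_leq le_tp -ltnS ltn_ord.
Qed.

(** Only the minor without the first row, which is triangular, is evaluated directly. The others
    follow from [sminors_mul]: column p says that a times minor p+1 equals b times minor p. *)
Lemma sminors_Hmx t : sminors (Hmx a b t) = \row_p (a ^+ (t - p) * b ^+ p).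
Proof.
pose S (p : nat) := sminors (Hmx a b t) 0 (inord p).
suff SE p : (p <= t)%N -> S p = a ^+ (t - p) * b ^+ p.
  by apply/rowP => p; rewrite [RHS]mxE -SE -1?ltnS // /S inord_val.
elim: p => [_|p IH lt_pt].
  rewrite /S (_ : inord 0 = ord0); last by apply: val_inj; rewrite /= inordK.
  rewrite mxE mul1r mulr1 subn0 -det_tr det_trig.
    rewrite (eq_bigr (fun=> a)) ?prodr_const ?card_ord // => q _.
    by rewrite 2!mxE HmxE /= eqxx gtn_eqF // mulr1 mulr0 subr0.
  apply/is_trig_mxP => i j lt_ij; rewrite 2!mxE HmxE /= !gtn_eqF ?mulr0 ?subr0 //.
  exact: ltnW.
have := congr1 (fun B : 'rV_t => B 0 (Ordinal lt_pt)) (sminors_mul (Hmx a b t)).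
rewrite /= !mxE.
have -> : \sum_j sminors (Hmx a b t) 0 j * Hmx a b t j (Ordinal lt_pt) =
   a * (\sum_(j < t.+1) (p.+1 == j)%:R * S j) - b * (\sum_(j < t.+1) (p == j)%:R * S j).
  rewrite !mulr_sumr -sumrB; apply: eq_bigr => j _; rewrite HmxE /S inord_val /=.
  by rewrite [j == p.+1 :> nat]eq_sym [j == p :> nat]eq_sym; ring.
rewrite !sum_delta !ltnS lt_pt (ltnW lt_pt) IH ?(ltnW lt_pt) // => /eqP.
rewrite subr_eq0 => /eqP Sp; apply: (mulfI a0); rewrite {}Sp.
by rewrite -[in LHS](subnSK lt_pt) !exprS; ring.
Qed.

Lemma hilbert_burch_Hmx t : hilbert_burch_exact (Hmx a b t).
Proof.
split=> [v Hv|u].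
  pose w q := if q is q'.+1 then if insub q' is Some i then v i 0 else 0 else 0.
  have wE (q : 'I_t) : w q.+1 = v q 0 by rewrite /w valK.
  have wt : w t.+1 = 0 by rewrite /w insubF // ltnn.
  (* Row q of H v = 0 reads a w_q = b w_(q+1), so vanishing spreads upwards from w_0 = 0. *)
  have w0 q : (q <= t)%N -> w q = 0.
    elim: q => // q IH lt_qt.
    have := Hmx_mulE (erefl : w 0%N = 0) wt wE (inord q).
    rewrite Hv mxE inordK ?ltnS ?(ltnW lt_qt) // IH ?(ltnW lt_qt) // mulr0 sub0r.
    by move/esym/eqP; rewrite oppr_eq0 mulf_eq0 (negPf b0) => /eqP.
  by apply/colP => q; rewrite -wE w0 ?mxE.
rewrite sminors_Hmx => /(congr1 (fun B : 'M_1 => B 0 0)); rewrite !mxE => Eu.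
have /(monomial_syzygy (u := fun q => u (inord q) 0))[v [v0 vt vE]] :
    \sum_(q < t.+1) a ^+ (t - q) * b ^+ q * u (inord q) 0 = 0.
  by rewrite -[RHS]Eu; apply: eq_bigr => q _; rewrite mxE inord_val.
exists (\col_(q < t) v q.+1); apply/colP => p.
rewrite (Hmx_mulE v0 vt) => [|q]; last by rewrite mxE.
by rewrite -vE -1?ltnS // inord_val.
Qed.

Variable n : nat.
Hypothesis n_gt1 : (1 < n)%N.

Definition monomial_row : 'rV[A]_n := \row_q (a ^+ (n.-1 - q) * b ^+ q).

(** The cyclic successor [ordS] covers the superdiagonal and the corner entry (n,1) at once. *)
Lemma CmxE p q : Cmx a b n p q = a * (p == q)%:R - b * (q == ordS p)%:R.
Proof.
have lt_p := ltn_ord p; have lt_q := ltn_ord q.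
rewrite mxE -[q == ordS p]/((q : nat) == p.+1 %% n)%N; case: eqP => [->|ne_pq].
  rewrite (_ : (q == _ :> nat) = false) ?mulr1 ?mulr0 ?subr0 //; apply/eqP.
  by move: lt_q; rewrite leq_eqVlt => /predU1P[qn|lt]; [rewrite qn modnn | rewrite modn_small]; lia.
move: lt_p; rewrite leq_eqVlt => /predU1P[pn|lt].
  rewrite pn eqxx /= modnn (_ : (q == n :> nat) = false); last by apply/eqP; lia.
  by case: eqP => _; rewrite ?mulr1 !mulr0 !sub0r ?oppr0.
rewrite modn_small // (ltn_eqF lt) /=.
by case: eqP => _; rewrite ?mulr1 !mulr0 !sub0r ?oppr0.
Qed.

Lemma mul_row_Cmx (u : 'rV_n) q :
  (u *m Cmx a b n) 0 q = a * u 0 q - b * u 0 (ord_pred q).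
Proof.
rewrite mxE (eq_bigr (fun p => a * (if p == q then u 0 p else 0)
                           - b * (if p == ord_pred q then u 0 p else 0))).
  by rewrite sumrB -!mulr_sumr -!big_mkcond !big_pred1_eq.
move=> p _; rewrite CmxE.
rewrite (_ : (q == ordS p) = (p == ord_pred q)); first by do 2!case: eqP => _ /=; ring.
by apply/eqP/eqP => ->; rewrite ?ordSK ?ord_predK.
Qed.

Lemma mul_Cmx_col (v : 'cV_n) p :
  (Cmx a b n *m v) p 0 = a * v p 0 - b * v (ordS p) 0.
Proof.
rewrite mxE (eq_bigr (fun q => a * (if q == p then v q 0 else 0)
                           - b * (if q == ordS p then v q 0 else 0))).
  by rewrite sumrB -!mulr_sumr -!big_mkcond !big_pred1_eq.
by move=> q _; rewrite CmxE [p == q]eq_sym; do 2!case: eqP => _ /=; ring.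
Qed.

Lemma monomial_row_Cmx :
  monomial_row *m Cmx a b n = \row_q (if q == 0 :> nat then a ^+ n - b ^+ n else 0).
Proof.
apply/rowP => q; rewrite mul_row_Cmx !mxE /=; have lt_q := ltn_ord q.
case: eqP => [->|/eqP]; last rewrite -lt0n => q_gt0.
  rewrite add0n modn_small ?prednK ?subn0 ?subnn ?(ltnW n_gt1) //.
  by rewrite -{3 4}(prednK (ltnW n_gt1)) !exprS; ring.
have -> : ((q + n).-1 %% n = q.-1)%N.
  by rewrite -(prednK q_gt0) addSn /= modnDr modn_small //; lia.
have -> : (n.-1 - q.-1 = (n.-1 - q).+1)%N by lia.
by rewrite -{2}(prednK q_gt0) !exprS; ring.
Qed.

(** Multiply [monomial_row_Cmx] by the adjugate and compare first entries: a^(n-1) det C = (a^n -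
    b^n) times the first cofactor. That cofactor is triangular with value a^(n-1), which cancels. *)
Lemma det_Cmx : \det (Cmx a b n) = a ^+ n - b ^+ n.
Proof.
pose i0 := Ordinal (ltnW n_gt1).
have cof0 : cofactor (Cmx a b n) i0 i0 = a ^+ n.-1.
  rewrite /cofactor mul1r -det_tr det_trig.
    rewrite (eq_bigr (fun=> a)) ?prodr_const ?card_ord // => q _.
    have lt_q := ltn_ord q.
    rewrite 3!mxE CmxE eqxx mulr1 (_ : (_ == _) = false) ?mulr0 ?subr0 //.
    apply/eqP => /(congr1 val) /=; rewrite /bump /= !add1n.
    have [lt|ge] := ltnP q.+2 n; first by rewrite modn_small //; lia.
    by rewrite (_ : q.+2 = n) ?modnn //; lia.
  apply/is_trig_mxP => i j lt_ij; have lt_j := ltn_ord j.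
  rewrite 3!mxE CmxE (inj_eq (@lift_inj _ _)) -val_eqE /= gtn_eqF // mulr0.
  rewrite (_ : (_ == _) = false) ?mulr0 ?subr0 //.
  apply/eqP => /(congr1 val) /=; rewrite /bump /= !add1n.
  have [lt|ge] := ltnP j.+2 n; first by rewrite modn_small //; lia.
  by rewrite (_ : j.+2 = n) ?modnn //; lia.
have := congr1 (fun B : 'rV_n => B 0 i0) (congr1 (mulmxr (\adj (Cmx a b n))) monomial_row_Cmx).
rewrite /= -mulmxA mul_mx_adj mul_mx_scalar !mxE subn0 mulr1 (bigD1 i0) //= big1 ?addr0.
  rewrite !mxE /= cof0; apply: mulIf; exact: expf_neq0.
by move=> q q0; rewrite !mxE (negPf (_ : q != 0 :> nat)) // mul0r.
Qed.

(** The sequence from [monomial_syzygy] vanishes at both 0 and n, so it closes up cyclically and is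
    a preimage under C(a,b). *)
Lemma monomial_row_exact (u : 'cV_n) :
  monomial_row *m u = 0 -> exists v, u = Cmx a b n *m v.
Proof.
move=> /(congr1 (fun B : 'M_1 => B 0 0)); rewrite !mxE => Eu.
have n_gt0 := ltnW n_gt1.
pose U q := if insub q is Some i then u i 0 else 0.
have /(monomial_syzygy (u := U))[v [v0 vt vE]] : \sum_(q < n.-1.+1) a ^+ (n.-1 - q) * b ^+ q * U q = 0.
  by rewrite prednK // -[RHS]Eu; apply: eq_bigr => q _; rewrite mxE /U valK.
exists (\col_(q < n) v q); apply/colP => p; rewrite mul_Cmx_col !mxE /=.
have := vE p; rewrite /U valK => -> //; last by rewrite -ltnS prednK.
congr (_ - b * _); have := ltn_ord p; rewrite leq_eqVlt => /predU1P[->|lt].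
  by rewrite modnn v0 -(prednK n_gt0).
by rewrite modn_small.
Qed.

End KoszulMatrices.

(** * Gradings and reduction modulo x^n - y^n *)

Definition divides (A : comNzRingType) (d u : A) : Prop := exists w, u = d * w.

Lemma divides_closed (A : comNzRingType) (d : A) : ideal_closed (divides d).
Proof.
split=> [|b c [v ->] [w ->]|r c [v ->]]; first by exists 0; rewrite mulr0.
  by exists (v + w); rewrite mulrDr.
by exists (r * v); rewrite mulrCA.
Qed.

Lemma dividesX (A : comNzRingType) (a b : A) n : divides (a - b) (a ^+ n - b ^+ n).
Proof. by rewrite subrXX; eexists. Qed.

Section Grading.
Variable A : idomainType.
Implicit Types (x y z u v w d e : A) (g phi : {rmorphism A -> {poly A}}).

(* g reads off the grading of A by the degree in x and y alone: it multiplies x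
   and y by the new variable and fixes z. *)
Definition is_grading x y z g : Prop :=
  [/\ forall u, (g u).[1] = u, forall u i, pow2 x y i (g u)`_i,
      g x = x *: 'X, g y = y *: 'X & g z = z%:P].

(* phi rewrites the elements of A as polynomials in y. *)
Definition is_expansion x y z phi : Prop :=
  [/\ forall u, (phi u).[y] = u, phi x = x%:P, phi y = 'X & phi z = z%:P].

Section Order.
Variables (x y z : A) (g : {rmorphism A -> {poly A}}).
Hypothesis gP : is_grading x y z g.

Lemma gradeXl n : g (x ^+ n) = x ^+ n *: 'X^n.
Proof. by case: gP => _ _ gx _ _; rewrite rmorphXn /= gx exprZn. Qed.

Lemma gradeXr n : g (y ^+ n) = y ^+ n *: 'X^n.
Proof. by case: gP => _ _ _ gy _; rewrite rmorphXn /= gy exprZn. Qed.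

Lemma gradeX0 n : g (z ^+ n) = (z ^+ n)%:P.
Proof. by case: gP => _ _ _ _ gz; rewrite rmorphXn /= gz rmorphXn. Qed.

(** An element is the sum of its components, and the component of degree i lies in (x,y)^i.
    Conversely [g] sends a monomial of degree m to a multiple of X^m. *)
Lemma pow2_gradeP m u : pow2 x y m u <-> forall i, (i < m)%N -> (g u)`_i = 0.
Proof.
have [g1 gpow _ _ _] := gP; split=> [|u0].
  move: u; apply: idl_gen_min => [|q i lt_im].
    split=> [i _|u v u0 v0 i lt_im|r u u0 i lt_im].
    - by rewrite rmorph0 coef0.
    - by rewrite rmorphD coefD u0 ?v0 ?addr0.
    - rewrite rmorphM coefM big1 // => j _.
      by rewrite u0 ?mulr0 //; apply: leq_ltn_trans lt_im; apply: leq_subr.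
  rewrite rmorphM /= gradeXl gradeXr -scalerAl -scalerAr -exprD scalerA coefZ coefXn.
  by rewrite subnK -1?ltnS // ltn_eqF // mulr0.
rewrite -[u]g1 horner_coef; have [P0 PD _] := pow2_closed x y m.
elim/big_ind: _ => // i _; rewrite expr1n mulr1.
by have [/u0 -> //|/pow2_le] := ltnP i m; apply; apply: gpow.
Qed.

(** The part of [d] of degree 0 is nonzero, so the lowest component of u survives multiplication by
    [d]. *)
Lemma pow2_cancel_order0 d m u : (g d)`_0 != 0 -> pow2 x y m (d * u) -> pow2 x y m u.
Proof.
move=> d0 /pow2_gradeP du; apply/pow2_gradeP.
elim/ltn_ind => i IH lt_im; apply: (mulfI d0); rewrite mulr0 -[RHS](du i lt_im).
rewrite rmorphM coefM big_ord_recl subn0 big1 ?addr0 // => j _.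
have lt_j := ltn_ord j.
by rewrite [(g u)`_ _]IH ?mulr0 //= /bump /=; lia.
Qed.

(** The form is homogeneous of degree n for [g], so it shifts every component by exactly n. *)
Lemma pow2_cancel_form n m u : x ^+ n - y ^+ n != 0 ->
  pow2 x y (m + n) ((x ^+ n - y ^+ n) * u) -> pow2 x y m u.
Proof.
move=> d0 /pow2_gradeP du; apply/pow2_gradeP => i lt_im.
have := du (i + n)%N; rewrite ltn_add2r => /(_ lt_im).
rewrite rmorphM rmorphB /= gradeXl gradeXr -scalerBl -scalerAl mulrC coefZ coefMXn.
by rewrite ltnNge leq_addl addnK /= => /eqP; rewrite mulf_eq0 (negPf d0) => /eqP.
Qed.

End Order.

(** * Normal forms modulo x^n - y^n *)

Section Reduction.
Variables (x y z : A) (phi : {rmorphism A -> {poly A}}) (n : nat).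
Hypotheses (phiP : is_expansion x y z phi) (n_gt0 : (0 < n)%N).
Local Notation d := (x ^+ n - y ^+ n).

Definition reduced_monomial k : A := x ^+ (n * (k %/ n)) * y ^+ (k %% n).

Definition reduce_poly (P : {poly A}) : A := \sum_(k < size P) P`_k * reduced_monomial k.

(* The normal form modulo x^n - y^n: y^n is replaced by x^n. *)
Definition reduce u := reduce_poly (phi u).

Lemma reduce_polyE B (P : {poly A}) : (size P <= B)%N ->
  reduce_poly P = \sum_(k < B) P`_k * reduced_monomial k.
Proof.
move=> leB; rewrite /reduce_poly (big_ord_widen _ (fun k => P`_k * reduced_monomial k) leB).
rewrite big_mkcond /=; apply: eq_bigr => k _; case: ltnP => // le_k.
by rewrite nth_default // mul0r.
Qed.

Lemma reduce_polyD P Q : reduce_poly (P + Q) = reduce_poly P + reduce_poly Q.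
Proof.
pose B := maxn (size P) (size Q).
rewrite (@reduce_polyE B (P + Q)) ?size_polyD // (@reduce_polyE B P) ?leq_maxl //.
rewrite (@reduce_polyE B Q) ?leq_maxr // -big_split; apply: eq_bigr => k _.
by rewrite coefD mulrDl.
Qed.

Lemma reduce_polyZ r P : reduce_poly (r%:P * P) = r * reduce_poly P.
Proof.
rewrite mul_polyC (@reduce_polyE (size P) (r *: P)) ?size_scale_leq // mulr_sumr.
by apply: eq_bigr => k _; rewrite coefZ mulrA.
Qed.

Lemma reduce_polyMXn P j :
  reduce_poly (P * 'X^j) = \sum_(k < size P) P`_k * reduced_monomial (j + k).
Proof.
rewrite (@reduce_polyE (j + size P)); last first.
  by rewrite (leq_trans (size_polyMleq _ _)) // size_polyXn addnS addnC.
rewrite big_split_ord /= big1 ?add0r => [|k _]; last by rewrite coefMXn ltn_ord mul0r.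
by apply: eq_bigr => k _; rewrite coefMXn ltnNge leq_addr addKn.
Qed.

Lemma expansionX k : phi (x ^+ k) = (x ^+ k)%:P.
Proof. by case: phiP => _ px _ _; rewrite rmorphXn /= px rmorphXn. Qed.

Lemma expansionY k : phi (y ^+ k) = 'X^k.
Proof. by case: phiP => _ _ py _; rewrite rmorphXn /= py. Qed.

Lemma expansionZ k : phi (z ^+ k) = (z ^+ k)%:P.
Proof. by case: phiP => _ _ _ pz; rewrite rmorphXn /= pz rmorphXn. Qed.

Lemma reduceD u v : reduce (u + v) = reduce u + reduce v.
Proof. by rewrite /reduce rmorphD reduce_polyD. Qed.

Lemma reduceM r u : phi r = r%:P -> reduce (r * u) = r * reduce u.
Proof. by move=> rE; rewrite /reduce rmorphM rE reduce_polyZ. Qed.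

Lemma reduce_form w : reduce (d * w) = 0.
Proof.
rewrite /reduce rmorphM rmorphB /= expansionX expansionY mulrBl.
rewrite -mulN1r -(polyCN 1) reduce_polyD !reduce_polyZ mulN1r [_ * phi w]mulrC.
rewrite reduce_polyMXn /reduce_poly mulr_sumr -sumrB big1 // => k _.
rewrite /reduced_monomial divnDl // modnDl divnn n_gt0 mulnDr muln1 exprD; ring.
Qed.

Lemma reduceP u : divides d (u - reduce u).
Proof.
have [phiy _ _ _] := phiP; rewrite -{1}[u]phiy.
have [D0 DD DM] := divides_closed d.
rewrite horner_coef /reduce /reduce_poly -sumrB; elim/big_ind: _ => // k _.
have -> : y ^+ k = y ^+ (n * (k %/ n)) * y ^+ (k %% n) by rewrite -exprD mulnC -divn_eq.
rewrite -mulrBr -mulrBl; apply: (DM).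
rewrite mulrC; apply: (DM); rewrite !exprM.
by have [w E] := dividesX (x ^+ n) (y ^+ n) (k %/ n); exists (- w); rewrite mulrN -E opprB.
Qed.

(** The normal form kills multiples of d and is linear over elements free of y, so e times the
    normal form of v is 0. Thus any nonzero [e] free of y is regular modulo d. *)
Lemma divides_cancel e v : phi e = e%:P -> e != 0 -> divides d (e * v) -> divides d v.
Proof.
move=> eE e0 [w] /(congr1 reduce); rewrite reduceM // reduce_form => /eqP.
rewrite mulf_eq0 (negPf e0) => /eqP r0.
by have := reduceP v; rewrite r0 subr0.
Qed.

Lemma divides_var_cancel e v : phi e = e%:P -> e != 0 -> divides y (e * v) -> divides y v.
Proof.
have [phiy _ py _] := phiP; move=> eE e0 [w] /(congr1 (fun u => (phi u)`_0)).
rewrite !rmorphM /= eE py coefCM coefXM => /eqP; rewrite mulf_eq0 (negPf e0) => /eqP v0.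
rewrite -[v]phiy horner_coef; have [D0 DD DM] := divides_closed y.
elim/big_ind: _ => // -[[|k] ltk] _ /=; first by rewrite v0 mul0r.
by apply: (DM); exists (y ^+ k); rewrite exprS.
Qed.

(** Reduction keeps the total degree in x and y of a monomial but brings the exponent of y down to
    at most n-1. With degree at least m+n, a factor x^(m+1) splits off and degree at least n-1
    remains. *)
Lemma reduce_pow2 m u : pow2 x y (m + n) u ->
  exists2 v, pow2 x y n.-1 v & reduce u = x ^+ m.+1 * v.
Proof.
pose Q v := exists2 v', pow2 x y n.-1 v' & v = x ^+ m.+1 * v'.
have [Q0 QD QM] : ideal_closed Q.
  have [P0 PD PM] := pow2_closed x y n.-1.
  split=> [|b c [v Hv ->] [w Hw ->]|r c [v Hv ->]].
  - by exists 0; rewrite ?mulr0.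
  - by exists (v + w); [apply: PD | rewrite mulrDr].
  - by exists (r * v); [apply: PM | rewrite mulrCA].
move=> Hu; suff: forall r, Q (reduce (r * u)) by move/(_ 1); rewrite mul1r.
move: u Hu; apply: idl_gen_min => [|q r].
  split=> [r|u v Hu Hv r|s u Hu r].
  - by rewrite mulr0 -[0](mul0r 0) reduceM ?rmorph0 // mul0r.
  - by rewrite mulrDr reduceD; apply: QD.
  - by rewrite mulrA.
rewrite mulrCA reduceM ?expansionX // /reduce rmorphM /= expansionY reduce_polyMXn.
rewrite mulr_sumr; elim/big_ind: _ => // k _; rewrite mulrCA; apply: QM.
rewrite /reduced_monomial mulrA -exprD.
have lt_mod : ((q + k) %% n < n)%N by rewrite ltn_mod.
have := divn_eq (q + k) n; rewrite mulnC; have := ltn_ord q.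
set s := (n * _)%N; set t := (_ %% n)%N in lt_mod * => lt_q Es.
exists (x ^+ (m + n - q + s - m.+1) * y ^+ t); first by apply: pow2_monomial; lia.
by rewrite mulrA -exprD; congr (x ^+ _ * _); lia.
Qed.

Lemma pow2_mod_form g e m u v w : is_grading x y z g ->
    phi e = e%:P -> (g e)`_0 != 0 -> pow2 x y (m + n) u -> u = e * v + d * w ->
  exists v2 w', pow2 x y n.-1 v2 /\ v = x ^+ m.+1 * v2 + d * w'.
Proof.
move=> gP eE e0 Hu uE.
have ru : reduce u = e * reduce v by rewrite uE reduceD reduceM // reduce_form addr0.
have Hrv : pow2 x y (m + n) (reduce v).
  apply: (pow2_cancel_order0 gP e0); rewrite -ru; have [v1 Hv1 ->] := reduce_pow2 Hu.
  rewrite -(prednK n_gt0) addnS -addSn; apply: pow2_mul => //.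
  exact/pow2_exp1/pow2_memL.
(* Cancelling e has put [reduce v] itself into (x,y)^(m+n), so a second reduction extracts x^(m+1).
   Both reductions change v only by multiples of d. *)
have [v2 Hv2 rrv] := reduce_pow2 Hrv.
have [w1 w1E] := reduceP v; have [w2 w2E] := reduceP (reduce v).
exists v2, (w1 + w2); split=> //; rewrite -rrv mulrDr -w1E -w2E; ring.
Qed.

End Reduction.

(** In an expression of d u through the generators, all terms but the one with e^(N+1) carry a
    factor d. Regularity of e modulo d makes the coefficient of e^(N+1) divisible by d as well, and
    d can be cancelled. *)
Lemma pow2_colon_regular d e N u :
    (forall v, divides d (e * v) -> divides d v) -> d != 0 ->
  pow2 d e N.+1 (d * u) -> pow2 d e N u.
Proof.
move=> reg d0 [c]; rewrite big_ord_recr /= subnn mul1r.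
pose S := \sum_(q < N.+1) c (widen_ord (leqnSn N.+1) q) * (d ^+ (N - q) * e ^+ q).
have -> : \sum_(q < N.+1) c (widen_ord (leqnSn N.+1) q) * (d ^+ (N.+1 - q) * e ^+ q) = d * S.
  rewrite mulr_sumr; apply: eq_bigr => q _.
  by rewrite subSn -1?ltnS // exprS; ring.
move=> E; have rege q v : divides d (e ^+ q * v) -> divides d v.
  by elim: q => [|q IH]; rewrite ?mul1r // exprS -mulrA => /reg.
have /rege[w cw] : divides d (e ^+ N.+1 * c ord_max).
  by exists (u - S); rewrite mulrBr E; ring.
have -> : u = S + w * e ^+ N.+1 by apply: (mulfI d0); rewrite E cw; ring.
apply: pow2_add; last by apply: pow2_mulr; apply: pow2_le (leqnSn N) _; apply/pow2_exp1/pow2_memR.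
have [P0 PD PM] := pow2_closed d e N.
by rewrite /S; elim/big_ind: _ => // q _; apply: (PM); apply: pow2_monomial; rewrite subnK // -ltnS.
Qed.

Definition coordinate_triple x y z : Prop :=
  (exists g, is_grading x y z g) /\ (exists phi, is_expansion x y z phi).

(* x, y, z behave like the variables of K[x,y,z]. *)
Definition coordinates x y z : Prop :=
  [/\ coordinate_triple x y z, coordinate_triple y z x, coordinate_triple z x y,
      (exists g, is_grading x z y g) & [/\ x != 0, y != 0 & z != 0]].

End Grading.

(** * The inductive step for intersections of ideal powers *)

Section IdealStep.
Variable A : idomainType.
Variables (x y z : A) (n : nat).
Local Notation d := (x ^+ n - y ^+ n).
Local Notation e := (z ^+ n - x ^+ n).
Local Notation e' := (y ^+ n - z ^+ n).
Hypothesis n_gt0 : (0 < n)%N.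
Variables gxy gyz gxz phi : {rmorphism A -> {poly A}}.
Hypotheses (gxyP : is_grading x y z gxy) (gyzP : is_grading y z x gyz)
  (gxzP : is_grading x z y gxz) (phiP : is_expansion x y z phi).
Hypotheses (x0 : x != 0) (y0 : y != 0) (z0 : z != 0).

Lemma coef0_e : (gxy e)`_0 = z ^+ n.
Proof.
rewrite rmorphB /= (gradeX0 gxyP) (gradeXl gxyP) coefB coefC eqxx coefZ coefXn.
by rewrite ltn_eqF //= mulr0 subr0.
Qed.

Lemma coef0_yz_d : (gyz d)`_0 = x ^+ n.
Proof.
rewrite rmorphB /= (gradeX0 gyzP) (gradeXl gyzP) coefB coefC eqxx coefZ coefXn.
by rewrite ltn_eqF //= mulr0 subr0.
Qed.

Lemma coef0_xz_d : (gxz d)`_0 = - y ^+ n.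
Proof.
rewrite rmorphB /= (gradeX0 gxzP) (gradeXl gxzP) coefB coefC eqxx coefZ coefXn.
by rewrite ltn_eqF //= mulr0 sub0r.
Qed.

Lemma phi_e : phi e = e%:P.
Proof. by rewrite rmorphB /= (expansionX phiP) (expansionZ phiP) rmorphB. Qed.

Lemma d_neq0 : d != 0.
Proof.
apply: contraNneq (expf_neq0 n x0) => d0.
by rewrite -coef0_yz_d d0 rmorph0 coef0.
Qed.

Lemma e_neq0 : e != 0.
Proof.
apply: contraNneq (expf_neq0 n z0) => e0.
by rewrite -coef0_e e0 rmorph0 coef0.
Qed.

Lemma divides_d_e v : divides d (e * v) -> divides d v.
Proof. exact: (divides_cancel phiP n_gt0 phi_e e_neq0). Qed.

Lemma divides_d_ex p q v : divides d (e ^+ p * x ^+ q * v) -> divides d v.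
Proof.
apply: (divides_cancel phiP n_gt0); last by rewrite mulf_neq0 ?expf_neq0 ?e_neq0.
by rewrite (rmorphM phi) (rmorphXn phi) /= phi_e (expansionX phiP) polyCM !polyC_exp.
Qed.

Variables (N m m1 m2 al be : nat).
Hypotheses (Nab : (al + be = N.+1)%N) (le_m1 : (m1 <= n * al)%N) (le_m2 : (m2 <= n * be + m.+1)%N).

(** The bound on [m1] puts e'^al into (y,z)^m1, the bound on [m2] puts e^be x^(m+1) into (x,z)^m2,
    and al + be = N+1 puts F into (d,e)^(N+1). In the application m is i n. *)
Let F := e' ^+ al * e ^+ be * x ^+ m.+1.

(** From d + e + e' = 0 one has e' = -e modulo d. *)
Lemma F_mod_d : divides d (F - (-1) ^+ al * (e ^+ N.+1 * x ^+ m.+1)).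
Proof.
have [w E] : divides d (e' ^+ al - (- e) ^+ al).
  have [w E] := dividesX e' (- e) al; exists (- w).
  by rewrite E; ring.
exists (w * e ^+ be * x ^+ m.+1).
by rewrite !mulrA -E /F -Nab exprD (exprNn (z ^+ n - x ^+ n)); ring.
Qed.

Lemma divides_d_F v w : F * v = d * w -> divides d v.
Proof.
move=> E; have [w' FE] := F_mod_d.
apply: (@divides_d_ex N.+1 m.+1); exists ((-1) ^+ al * (w - w' * v)).
have -> : d * ((-1) ^+ al * (w - w' * v)) = (-1) ^+ al * (d * w - d * w' * v) by ring.
rewrite -E -FE; set s := (-1) ^+ al; set G := e ^+ _ * _.
have -> : s * (F * v - (F - s * G) * v) = (s * s) * (G * v) by ring.
by rewrite -expr2 sqrr_sign mul1r.
Qed.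

Definition old_intersection u := [/\ pow2 d e N u, pow2 x y m u, pow2 y z m1 u & pow2 x z m2 u].
Definition new_intersection u := [/\ pow2 d e N.+1 u, pow2 x y (m + n) u, pow2 y z m1 u & pow2 x z m2 u].

Lemma ideal_step u :
  new_intersection u <-> exists v v2, [/\ old_intersection v, pow2 x y n.-1 v2 & u = d * v + F * v2].
Proof.
have powB (a b : A) : pow2 a b n (a ^+ n - b ^+ n).
  by apply: pow2_sub; apply: pow2_exp1; [apply: pow2_memL | apply: pow2_memR].
have powB' (a b : A) : pow2 a b n (b ^+ n - a ^+ n) by apply/pow2C/powB.
have F_new v2 : pow2 x y n.-1 v2 -> new_intersection (F * v2).
  move=> Hv2; split.
  - apply: pow2_mull; apply: pow2_mull; rewrite -Nab; apply: pow2_mul; apply: pow2_exp1.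
      have -> : e' = -1 * d + -1 * e by ring.
      by apply: pow2_add; apply: pow2_mulr; [apply: pow2_memL | apply: pow2_memR].
    exact: pow2_memR.
  - rewrite /F -mulrA; apply: pow2_mulr.
    rewrite -(prednK n_gt0) addnS -addSn; apply: pow2_mul => //.
    exact/pow2_exp1/pow2_memL.
  - rewrite /F -!mulrA; apply: pow2_mull; apply: pow2_le le_m1 _; exact: pow2_exp.
  - apply: pow2_mull; rewrite /F -mulrA; apply: pow2_mulr; apply: pow2_le le_m2 _.
    by apply: pow2_mul; [apply: pow2_exp | apply/pow2_exp1/pow2_memL].
have new_sub v w : new_intersection v -> new_intersection w -> new_intersection (v - w).
  by move=> [? ? ? ?] [? ? ? ?]; split; apply: pow2_sub.
split=> [Ju|[v [v2 [[Jv Jv1 Jv2 Jv3] Hv2 ->]]]].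
  (* All generators of (d,e)^(N+1) other than e^(N+1) are multiples of d. *)
  have [v [w uE]] : exists v w, u = e ^+ N.+1 * v + d * w.
    case: Ju => [[c ->] _ _ _]; rewrite big_ord_recr /= subnn mul1r.
    have [D0 DD DM] := divides_closed d.
    have [w ->] : divides d (\sum_(i < N.+1) c (widen_ord (leqnSn N.+1) i) * (d ^+ (N.+1 - i) * e ^+ i)).
      elim/big_ind: _ => // q _; rewrite subSn -1?ltnS // exprS -mulrA mulrCA.
      by eexists.
    by exists (c ord_max), w; rewrite addrC mulrC.
  have c0 : (gxy (e ^+ N.+1))`_0 != 0.
    rewrite (rmorphXn gxy) /= -(horner_coef0 (gxy e ^+ _)) horner_exp horner_coef0 coef0_e.
    by rewrite !expf_neq0.
  have phieN : phi (e ^+ N.+1) = (e ^+ N.+1)%:P by rewrite (rmorphXn phi) /= phi_e polyC_exp.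
  have Jxy : pow2 x y (m + n) u by case: Ju.
  have [v2 [w' [Hv2 vE]]] := pow2_mod_form phiP n_gt0 gxyP phieN c0 Jxy uE.
  have [w2 FE] := F_mod_d.
  (* Collects the multiples of d: those from writing v as x^(m+1) v2 plus d w', and the one from
     trading e^(N+1) x^(m+1) for F up to sign. *)
  pose w3 := e ^+ N.+1 * w' + w - w2 * ((-1) ^+ al * v2).
  have uE' : u = d * w3 + F * ((-1) ^+ al * v2).
    rewrite uE vE /w3.
    have -> : F = d * w2 + (-1) ^+ al * (e ^+ N.+1 * x ^+ m.+1) by rewrite -FE subrK.
    have s1 : (-1) ^+ al * (-1) ^+ al = 1 :> A by rewrite -expr2 sqrr_sign.
    have -> : (d * w2 + (-1) ^+ al * (e ^+ N.+1 * x ^+ m.+1)) * ((-1) ^+ al * v2) =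
      d * w2 * ((-1) ^+ al * v2) + ((-1) ^+ al * (-1) ^+ al) * (e ^+ N.+1 * x ^+ m.+1) * v2 by ring.
    rewrite s1; ring.
  have Hs : pow2 x y n.-1 ((-1) ^+ al * v2) by apply: pow2_mulr.
  exists w3, ((-1) ^+ al * v2); split=> //.
  have : new_intersection (d * w3) by rewrite -[d * w3](addrK (F * ((-1) ^+ al * v2))) -uE'; apply/new_sub/F_new.
  (* Dividing by d lowers the order by one for (d,e) and by n for (x,y). It costs nothing for (y,z)
     and (x,z), where d has a nonzero part of degree 0. *)
  case=> H1 H2 H3 H4; split.
  - by apply: pow2_colon_regular H1; [apply: divides_d_e | apply: d_neq0].
  - by apply: (pow2_cancel_form gxyP) H2; apply: d_neq0.
  - by apply: (pow2_cancel_order0 gyzP) H3; rewrite coef0_yz_d expf_neq0.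
  - by apply: (pow2_cancel_order0 gxzP) H4; rewrite coef0_xz_d oppr_eq0 expf_neq0.
have [F1 F2 F3 F4] := F_new _ Hv2; split; apply: pow2_add => //.
- by rewrite -add1n; apply: pow2_mul => //; apply: pow2_memL.
- by rewrite addnC; apply: pow2_mul.
- exact: pow2_mulr.
- exact: pow2_mulr.
Qed.

End IdealStep.

(** * Polynomial rings *)

Section MorphismClosure.
Variable A : comNzRingType.
Variable g : {rmorphism A -> {poly A}}.

Lemma horner_id_add c (p q : A) : (g p).[c] = p -> (g q).[c] = q -> (g (p + q)).[c] = p + q.
Proof. by move=> pE qE; rewrite rmorphD hornerD pE qE. Qed.

Lemma horner_id_mul c (p q : A) : (g p).[c] = p -> (g q).[c] = q -> (g (p * q)).[c] = p * q.
Proof. by move=> pE qE; rewrite rmorphM hornerM pE qE. Qed.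

Lemma pow2_coef_add x y (p q : A) :
    (forall i, pow2 x y i (g p)`_i) -> (forall i, pow2 x y i (g q)`_i) ->
  forall i, pow2 x y i (g (p + q))`_i.
Proof. by move=> Hp Hq i; rewrite rmorphD coefD; apply: pow2_add. Qed.

Lemma pow2_coef_mul x y (p q : A) :
    (forall i, pow2 x y i (g p)`_i) -> (forall i, pow2 x y i (g q)`_i) ->
  forall i, pow2 x y i (g (p * q))`_i.
Proof.
move=> Hp Hq i; rewrite rmorphM coefM; have [P0 PD _] := pow2_closed x y i.
elim/big_ind: _ => // k _; have := pow2_mul (Hp k) (Hq (i - k)%N).
by rewrite subnKC // -ltnS.
Qed.

Lemma pow2_coef_const x y (p : A) : g p = p%:P -> forall i, pow2 x y i (g p)`_i.
Proof.
move=> -> i; rewrite coefC; case: eqP => [->|_]; first exact: pow2_0.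
by case: (pow2_closed x y i).
Qed.

Lemma pow2_coef_var x y (p : A) : pow2 x y 1 p -> g p = p *: 'X ->
  forall i, pow2 x y i (g p)`_i.
Proof.
move=> Hp -> i; rewrite coefZ coefX; case: eqP => [->|_]; first by rewrite mulr1.
by rewrite mulr0; case: (pow2_closed x y i).
Qed.

End MorphismClosure.

Section Polynomials.
Variables (K : fieldType) (N : nat).
Local Notation R := {mpoly K[N]}.

Lemma mpoly_ring_ind (P : R -> Prop) :
    (forall c, P c%:MP) -> (forall i, P 'X_i) ->
    (forall p q, P p -> P q -> P (p + q)) ->
    (forall p q, P p -> P q -> P (p * q)) ->
  forall p, P p.
Proof.
move=> PC PX PD PM p; rewrite [p]mpolyE; elim/big_ind: _ => // [|m _].
  by rewrite -mpolyC0.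
rewrite -mul_mpolyC mpolyXE_id; apply: (PM) => //.
elim/big_ind: _ => // [|i _]; first by rewrite -mpolyC1.
by elim: (m i) => [|k IH]; [rewrite expr0 -mpolyC1 | rewrite exprS; apply: PM].
Qed.

Definition subst_poly (h : 'I_N -> {poly R}) (u : R) : {poly R} :=
  mmap (polyC \o @mpolyC N K) h u.

HB.instance Definition _ h :=
  GRing.RMorphism.copy (subst_poly h) (mmap (polyC \o @mpolyC N K) h).

Lemma subst_polyC h c : subst_poly h c%:MP = c%:MP%:P.
Proof. exact: mmapC. Qed.

Lemma subst_polyX h i : subst_poly h 'X_i = h i.
Proof. by rewrite /subst_poly mmapX mmap1U. Qed.

Lemma mpolyXU_neq0 (i : 'I_N) : ('X_i : R) != 0.
Proof. by rewrite -msize_poly_eq0 msizeX. Qed.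

Lemma horner_subst_poly h v : (forall i, (h i).[v] = 'X_i) ->
  forall u, (subst_poly h u).[v] = u.
Proof.
move=> hv; apply: mpoly_ring_ind => [c|i|p q|p q].
- by rewrite subst_polyC hornerC.
- by rewrite subst_polyX.
- exact: (@horner_id_add _ (subst_poly h)).
- exact: (@horner_id_mul _ (subst_poly h)).
Qed.

Lemma mpoly_grading (a b c : 'I_N) : a != c -> b != c ->
  exists g, @is_grading {mpoly K[N]} 'X_a 'X_b 'X_c g.
Proof.
move=> ac bc.
pose h i : {poly R} := if (i == a) || (i == b) then 'X_i *: 'X else ('X_i)%:P.
exists (subst_poly h).
have ga : subst_poly h 'X_a = 'X_a *: 'X by rewrite subst_polyX /h eqxx.
have gb : subst_poly h 'X_b = 'X_b *: 'X by rewrite subst_polyX /h eqxx orbT.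
have gc : subst_poly h 'X_c = ('X_c)%:P.
  by rewrite subst_polyX /h ![c == _]eq_sym (negPf ac) (negPf bc).
split=> //.
  apply: horner_subst_poly => i; rewrite /h; case: ifP => _; last exact: hornerC.
  by rewrite hornerZ hornerX mulr1.
apply: mpoly_ring_ind => [k|i|p q|p q].
- exact/(@pow2_coef_const _ (subst_poly h))/subst_polyC.
- have := erefl (h i); rewrite {1}/h; case: ifP => [/orP i_ab|_] hi.
    apply: (@pow2_coef_var _ (subst_poly h)); last exact: etrans (subst_polyX h i) (esym hi).
    by case: i_ab => /eqP ->; [apply: pow2_memL | apply: pow2_memR].
  exact: (@pow2_coef_const _ (subst_poly h) _ _ _ (etrans (subst_polyX h i) (esym hi))).
- exact: (@pow2_coef_add _ (subst_poly h)).
- exact: (@pow2_coef_mul _ (subst_poly h)).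
Qed.

Lemma mpoly_expansion (a b c : 'I_N) : a != b -> c != b ->
  exists phi, @is_expansion {mpoly K[N]} 'X_a 'X_b 'X_c phi.
Proof.
move=> ab cb; pose h i : {poly R} := if i == b then 'X else ('X_i)%:P.
exists (subst_poly h).
have ha : subst_poly h 'X_a = ('X_a)%:P by rewrite subst_polyX /h (negPf ab).
have hb : subst_poly h 'X_b = 'X by rewrite subst_polyX /h eqxx.
have hc : subst_poly h 'X_c = ('X_c)%:P by rewrite subst_polyX /h (negPf cb).
split=> //; apply: horner_subst_poly => i; rewrite /h; case: eqP => [->|_].
  exact: hornerX.
exact: hornerC.
Qed.

End Polynomials.

Lemma pxyz_coordinates (K : fieldType) : coordinates (px K) (py K) (pz K).
Proof.
split; try (split; [exact: mpoly_grading | exact: mpoly_expansion]).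
  exact: mpoly_grading.
by split; apply: mpolyXU_neq0.
Qed.

(** * Adjoining one block *)

Section SumZero.
Variable A : comNzRingType.

(** Meant for f + g + h = 0: it lets each step use the pair of forms that fits its coordinates. *)
Lemma pow2_rot (p q r u : A) N : p + q + r = 0 -> pow2 p q N u -> pow2 q r N u.
Proof.
move=> pqr; apply: pow2_change; last exact: pow2_memL.
have -> : p = -1 * q + -1 * r + (p + q + r) by ring.
rewrite pqr addr0.
by apply: pow2_add; apply: pow2_mulr; [apply: pow2_memL | apply: pow2_memR].
Qed.

Lemma pow2_rotE (p q r u : A) N : p + q + r = 0 -> pow2 p q N u <-> pow2 q r N u.
Proof.
move=> pqr; split; first exact: pow2_rot.
move=> H; apply: (@pow2_rot r); first by rewrite -pqr; ring.
by apply: (@pow2_rot q) H; rewrite -pqr; ring.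
Qed.

Lemma monomial_row_ideal (a b : A) n u : (0 < n)%N ->
  pow2 a b n.-1 u <-> exists w : 'cV_n, u = \sum_(q < n) a ^+ (n.-1 - q) * b ^+ q * w q 0.
Proof.
case: n => // n _; split=> [[w ->]|[w ->]].
  by exists (\col_q w q); apply: eq_bigr => q _; rewrite mxE mulrC.
by exists (fun q => w q 0); apply: eq_bigr => q _; rewrite mulrC.
Qed.

End SumZero.

Lemma is_grading_sym (A : idomainType) (x y z : A) g :
  is_grading x y z g -> is_grading y x z g.
Proof. by case=> g1 gp gx gy gz; split=> // u i; apply/pow2C/gp. Qed.

Lemma coordinates_rot (A : idomainType) (x y z : A) :
  coordinates x y z -> coordinates y z x.
Proof.
case=> Hx Hy Hz _ [x0 y0 z0]; split=> //.
by case: Hx => -[g /is_grading_sym gP] _; exists g.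
Qed.

Section MatrixStep.
Variable A : idomainType.
Variables (x y z : A) (n : nat).
Local Notation d := (x ^+ n - y ^+ n).
Local Notation e := (z ^+ n - x ^+ n).
Local Notation e' := (y ^+ n - z ^+ n).
Hypotheses (n_gt1 : (1 < n)%N) (xyz : coordinates x y z).

Lemma form_neq0 : d != 0.
Proof.
by case: xyz => _ [[g gP] _] _ _ [x0 _ _]; apply: d_neq0 gP x0; apply: ltnW.
Qed.

(** Modulo d the forms e' and -e agree. In rotated coordinates this is the regularity of g modulo f
    that exactness for H(f,g) requires. *)
Lemma divides_d_opposite_form v : divides d (e' * v) -> divides d v.
Proof.
case: xyz => -[[g gP] [phi phiP]] _ _ _ [_ _ z0].
move=> [w E]; apply: (divides_d_e (ltnW n_gt1) gP phiP z0); exists (- v - w).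
have -> : d * (- v - w) = - (d * v) - d * w by ring.
by rewrite -E; ring.
Qed.

Lemma syzygy_regular (v w : A) : y * v = x * w -> exists v', v = x * v'.
Proof.
case: xyz => _ _ [_ [phi phiP]] _ [_ y0 _] E.
by apply: (divides_var_cancel phiP (e := y)); [case: phiP | | exists w].
Qed.

Variables (m l : nat) (M : 'M[A]_(m.+1, m)) (v : 'cV[A]_l).
Let X : 'M[A]_((m + n).+1, m + n) := block_mx M (pad_corner m.+1 n v) 0 (Cmx x y n).

Lemma monomial_row_Z :
  monomial_row x y n *m Cmx x y n = \row_q (if q == 0 :> nat then d else 0).
Proof. by case: xyz => _ _ _ _ []; move=> *; apply: monomial_row_Cmx. Qed.

Lemma det_Z : \det (Cmx x y n) = d.
Proof. by apply: det_Cmx => //; case: xyz => _ _ _ _ []. Qed.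

Lemma sminors_step : sminors X =
  row_mx (d *: sminors M) (- (sminors M *m pad_top m.+1 v) 0 0 *: monomial_row x y n).
Proof.
exact: (sminors_block M (pad_top m.+1 v) monomial_row_Z det_Z form_neq0).
Qed.

Variables (N mm m1 m2 al be nu : nat).
Hypotheses (Nab : (al + be = N.+1)%N) (le_m1 : (m1 <= n * al)%N) (le_m2 : (m2 <= n * be + mm.+1)%N).
Let F := e' ^+ al * e ^+ be * x ^+ mm.+1.
Hypothesis cE : (sminors M *m pad_top m.+1 v) 0 0 = (-1) ^+ nu * F.

Lemma hilbert_burch_step : hilbert_burch_exact M -> hilbert_burch_exact X.
Proof.
case: (xyz) => -[[g gP] [phi phiP]] _ _ _ [x0 y0 z0].
apply: (hilbert_burch_block monomial_row_Z det_Z form_neq0 (ltnW n_gt1)) => [w|a b].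
  by apply: monomial_row_exact => //; apply: syzygy_regular.
rewrite cE => E.
apply: (@divides_d_F _ _ _ _ _ (ltnW n_gt1) _ _ gP phiP x0 z0 N mm al be Nab a ((-1) ^+ nu * b)).
have s1 : (-1) ^+ nu * (-1) ^+ nu = 1 :> A by rewrite -expr2 sqrr_sign.
by rewrite [RHS]mulrCA -E /F !mulrA s1 mul1r.
Qed.

Lemma idl_minors_step u : idl_minors X u <->
  exists b w, [/\ idl_minors M b, pow2 x y n.-1 w & u = d * b + F * w].
Proof.
have -> : idl_minors X u <-> _ := idl_minors_block M (pad_top m.+1 v) monomial_row_Z det_Z form_neq0 u.
have s1 : (-1) ^+ nu * (-1) ^+ nu = 1 :> A by rewrite -expr2 sqrr_sign.
split=> [[b [w [Hb ->]]]|[b [w [Hb /(monomial_row_ideal _ _ _ (ltnW n_gt1))[w' wE] ->]]]].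
  exists b, ((-1) ^+ nu * (monomial_row x y n *m w) 0 0); split=> //.
    apply: pow2_mulr; apply/(monomial_row_ideal _ _ _ (ltnW n_gt1)).
    by exists w; rewrite mxE; apply: eq_bigr => q _; rewrite mxE.
  by rewrite cE; ring.
exists b, ((-1) ^+ nu *: w'); split=> //.
have -> : (monomial_row x y n *m ((-1) ^+ nu *: w')) 0 0 = (-1) ^+ nu * w.
  by rewrite -scalemxAr mxE wE mxE; congr (_ * _); apply: eq_bigr => q _; rewrite mxE.
rewrite cE; congr (_ + _).
have -> : (-1) ^+ nu * F * ((-1) ^+ nu * w) = ((-1) ^+ nu * (-1) ^+ nu) * (F * w) by ring.
by rewrite s1 mul1r.
Qed.

Lemma idl_minors_ideal_step u :
  (forall u, idl_minors M u <->
    [/\ pow2 d e N u, pow2 x y mm u, pow2 y z m1 u & pow2 x z m2 u]) ->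
  idl_minors X u <->
    [/\ pow2 d e N.+1 u, pow2 x y (mm + n) u, pow2 y z m1 u & pow2 x z m2 u].
Proof.
move=> HM; rewrite idl_minors_step.
case: (xyz) => -[[g gP] [phi phiP]] [[g2 g2P] _] _ [g3 g3P] [x0 y0 z0].
have := ideal_step (ltnW n_gt1) gP g2P g3P phiP x0 y0 z0 Nab le_m1 le_m2 u.
rewrite /new_intersection => ->; split=> -[b [w [Hb Hw ->]]]; exists b, w; split=> //; exact/HM.
Qed.

End MatrixStep.

(** * Determinants and intersections for the Fermat forms *)

Section BinomialColumns.
Variable A : comNzRingType.
Variables (a b c : A) (t r : nat).
Hypothesis le_rt : (r <= t)%N.
Local Notation eps := (\row_(p < t.+1) (a ^+ (t - p) * b ^+ p)).

Lemma pad_botE m l (v : 'cV[A]_l) (lelm : (l <= m)%N)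
    (e : 'rV[A]_m) (e' : 'rV[A]_l) c0 :
  (forall (p : 'I_m) (q : 'I_l), p = (q + (m - l))%N :> nat -> e 0 p = c0 * e' 0 q) ->
  (e *m pad_bot m v) 0 0 = c0 * (e' *m v) 0 0.
Proof.
move=> ee'; rewrite !mxE mulr_sumr.
pose F p := if insub p is Some q then e 0 q * pad_bot m v q 0 else 0.
rewrite (eq_bigr (fun p : 'I_m => F p)) => [|p _]; last by rewrite /F valK.
rewrite -(big_mkord xpredT F) (big_cat_nat (n := m - l)) ?leq_subr //=.
rewrite big_nat big1 ?add0r => [|p /andP[_ lt_p]]; last first.
  rewrite /F; case: insubP => // q _ qp.
  by rewrite mxE leqNgt qp lt_p /= mulr0.
rewrite -[X in \sum_(X <= _ < _) _]add0n big_addn subKn // big_mkord.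
apply: eq_bigr => q _; have lt_qm : (q + (m - l) < m)%N by have := ltn_ord q; lia.
rewrite /F (insubT (fun i => (i < m)%N) lt_qm) /= mxE leq_addl addnK valK.
by rewrite mulrA; congr (_ * _); apply: ee'.
Qed.

(** This is the binomial theorem. For a = f and b = g the sum is -h, which is how powers of h enter
    through [S2] and [S3]. *)
Lemma monomials_Ecol s : \row_(p < s.+1) (a ^+ (s - p) * b ^+ p) *m Ecol A s = ((a + b) ^+ s)%:M.
Proof.
rewrite [LHS]mx11_scalar; congr (_%:M); rewrite mxE exprDn; apply: eq_bigr => p _.
by rewrite !mxE mulr_natr.
Qed.

Lemma monomials_delta :
  (eps *m (c *: \col_p (p == r :> nat)%:R)) 0 0 = c * (a ^+ (t - r) * b ^+ r).
Proof.
rewrite -scalemxAr mxE; congr (_ * _); rewrite mxE.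
have lt_r : (r < t.+1)%N by [].
rewrite (bigD1 (Ordinal lt_r)) //= !mxE eqxx mulr1 big1 ?addr0 // => p ne_p.
by rewrite !mxE (negPf (_ : p != r :> nat)) ?mulr0.
Qed.

Lemma monomials_pad_bot :
  (eps *m pad_bot t.+1 (c *: Ecol A r)) 0 0 = c * b ^+ (t - r) * (a + b) ^+ r.
Proof.
rewrite (@pad_botE _ _ _ _ _ (\row_(p < r.+1) (a ^+ (r - p) * b ^+ p)) (b ^+ (t - r))) //.
  by rewrite -scalemxAr monomials_Ecol !mxE eqxx mulr1n; ring.
move=> p q pE; rewrite !mxE pE subSS mulrCA -exprD; have lt_q := ltn_ord q.
by congr (_ ^+ _ * _ ^+ _); lia.
Qed.

Lemma monomials_pad_top :
  (eps *m pad_top t.+1 (c *: Ecol A r)) 0 0 = c * a ^+ (t - r) * (a + b) ^+ r.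
Proof.
rewrite (@pad_topE _ _ _ _ _ _ (\row_(p < r.+1) (a ^+ (r - p) * b ^+ p)) (a ^+ (t - r))) //.
  by rewrite -scalemxAr monomials_Ecol !mxE eqxx mulr1n; ring.
move=> p q pE; rewrite !mxE pE mulrA -exprD; have lt_q := ltn_ord q.
by congr (_ ^+ _ * _); lia.
Qed.

End BinomialColumns.

Section FermatIdeals.
Variable A : idomainType.
Variables (x y z : A) (n : nat).
Local Notation f := (y ^+ n - z ^+ n).
Local Notation g := (z ^+ n - x ^+ n).
Local Notation h := (x ^+ n - y ^+ n).

Definition fermat_cap N i1 i2 i3 (u : A) : Prop :=
  [/\ pow2 f g N u, pow2 x y (i1 * n) u, pow2 y z (i2 * n) u & pow2 x z (i3 * n) u].

Lemma pow2_hg N u : pow2 h g N u <-> pow2 f g N u.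
Proof.
rewrite (@pow2_rotE _ f g h); last by ring.
by split; apply: pow2C.
Qed.

Lemma pow2_fh N u : pow2 f h N u <-> pow2 f g N u.
Proof.
rewrite (@pow2_rotE _ f g h); last by ring.
rewrite (@pow2_rotE _ g h f); last by ring.
by split; apply: pow2C.
Qed.

Lemma pow2_gf N u : pow2 g f N u <-> pow2 f g N u.
Proof. by split; apply: pow2C. Qed.

Hypotheses (n_gt1 : (1 < n)%N) (xyz : coordinates x y z).
Variables (m l : nat) (M : 'M[A]_(m.+1, m)) (v : 'cV[A]_l).
Variables (N i al be nu : nat).
Hypotheses (Nab : (al + be = N.+1)%N) (le_al : (i <= al)%N).
Local Notation X a b :=
  (block_mx M (pad_corner m.+1 n v) 0 (Cmx a b n) : 'M[A]_((m + n).+1, m + n)).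
Local Notation col_val := ((sminors M *m pad_top m.+1 v) 0 0).

Lemma fermat_step1 :
    col_val = (-1) ^+ nu * (f ^+ al * g ^+ be * x ^+ (i * n).+1) ->
    (forall u, idl_minors M u <-> fermat_cap N i i i u) ->
  forall u, idl_minors (X x y) u <-> fermat_cap N.+1 i.+1 i i u.
Proof.
move=> cE HM u; rewrite (idl_minors_ideal_step n_gt1 xyz (m1 := i * n) (m2 := i * n) Nab _ _ cE).
- rewrite -mulSnr; split=> -[H1 H2 H3 H4]; split=> //; exact/pow2_hg.
- by rewrite mulnC leq_mul2l le_al orbT.
- lia.
move=> w; rewrite HM; split=> -[H1 H2 H3 H4]; split=> //; exact/pow2_hg.
Qed.

(** In the coordinates (y,z,x) the two unchanged ideals are (z,x) and (y,x). The latter already has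
    exponent (i+1)n, hence the bound on [be]; in the third step both do. *)
Lemma fermat_step2 : (i < be)%N ->
    col_val = (-1) ^+ nu * (g ^+ al * h ^+ be * y ^+ (i * n).+1) ->
    (forall u, idl_minors M u <-> fermat_cap N i.+1 i i u) ->
  forall u, idl_minors (X y z) u <-> fermat_cap N.+1 i.+1 i.+1 i u.
Proof.
move=> le_be cE HM u.
rewrite (idl_minors_ideal_step n_gt1 (coordinates_rot xyz) (m1 := i * n) (m2 := i.+1 * n) Nab _ _ cE).
- rewrite -mulSnr; split=> -[H1 H2 H3 H4]; split=> //; try exact: pow2C; exact/pow2_fh.
- by rewrite mulnC leq_mul2l le_al orbT.
- by apply: leq_trans (leq_addr _ _); rewrite mulnC leq_mul2l le_be orbT.
move=> w; rewrite HM; split=> -[H1 H2 H3 H4]; split=> //; try exact: pow2C; exact/pow2_fh.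
Qed.

Lemma fermat_step3 : (i < al)%N -> (i < be)%N ->
    col_val = (-1) ^+ nu * (h ^+ al * f ^+ be * z ^+ (i * n).+1) ->
    (forall u, idl_minors M u <-> fermat_cap N i.+1 i.+1 i u) ->
  forall u, idl_minors (X z x) u <-> fermat_cap N.+1 i.+1 i.+1 i.+1 u.
Proof.
move=> lt_al le_be cE HM u.
rewrite (idl_minors_ideal_step n_gt1 (coordinates_rot (coordinates_rot xyz)) (m1 := i.+1 * n) (m2 := i.+1 * n) Nab _ _ cE).
- rewrite -mulSnr; split=> -[H1 H2 H3 H4]; split=> //; try exact: pow2C; exact/pow2_gf.
- by rewrite mulnC leq_mul2l lt_al orbT.
- by apply: leq_trans (leq_addr _ _); rewrite mulnC leq_mul2l le_be orbT.
move=> w; rewrite HM; split=> -[H1 H2 H3 H4]; split=> //; try exact: pow2C; exact/pow2_gf.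
Qed.

End FermatIdeals.

(** * Membership of the prescribed determinants *)

Section PrescribedMembership.
Variable A : idomainType.
Variables (x y z : A) (n : nat).
Local Notation f := (y ^+ n - z ^+ n).
Local Notation g := (z ^+ n - x ^+ n).
Local Notation h := (x ^+ n - y ^+ n).

Lemma pow2_form (a b : A) i p : (i <= p)%N -> pow2 a b (i * n) ((a ^+ n - b ^+ n) ^+ p).
Proof.
move=> le_ip; apply: (@pow2_le _ _ _ (n * p)); first by rewrite mulnC leq_mul2l le_ip orbT.
by apply/pow2_exp/pow2_sub; apply: pow2_exp1; [apply: pow2_memL | apply: pow2_memR].
Qed.

Lemma pow2_varL (a b : A) i p : (i <= p)%N -> pow2 a b (i * n) (a ^+ (p * n).+1).
Proof.
move=> le_ip; apply: (@pow2_le _ _ _ (p * n).+1); first by rewrite ltnW // ltnS leq_mul2r le_ip orbT.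
exact/pow2_exp1/pow2_memL.
Qed.

Lemma pow2_varR (a b : A) i p : (i <= p)%N -> pow2 a b (i * n) (b ^+ (p * n).+1).
Proof. by move=> le_ip; apply/pow2C/pow2_varL. Qed.

Variables (N i p q : nat).
Hypothesis Npq : (N <= p + q)%N.

(** Here i belongs to X_(j-3) while the determinant belongs to j, so the variable has exponent
    (i+1)n+1. This suffices for both ideals containing that variable, and a power of a form handles
    the third. The same pattern governs the next two lemmas. *)
Lemma prescribed_cap1 : (i <= p)%N ->
  fermat_cap x y z n N i.+1 i i (f ^+ p * g ^+ q * x ^+ (i.+1 * n).+1).
Proof.
move=> le_ip; split.
- by apply: pow2_mull; apply: pow2_monomial.
- exact/pow2_mulr/pow2_varL.
- by apply: pow2_mull; apply: pow2_mull; apply: pow2_form.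
- exact/pow2_mulr/pow2_varL.
Qed.

Lemma prescribed_cap2 : (i <= p)%N ->
  fermat_cap x y z n N i.+1 i.+1 i (g ^+ p * h ^+ q * y ^+ (i.+1 * n).+1).
Proof.
move=> le_ip; split.
- apply: pow2_mull; apply/(@pow2_rotE _ f g h); first by ring.
  exact: pow2_monomial.
- exact/pow2_mulr/pow2_varR.
- exact/pow2_mulr/pow2_varL.
- by apply: pow2_mull; apply: pow2_mull; apply/pow2C/pow2_form.
Qed.

Lemma prescribed_cap3 : (i < q)%N ->
  fermat_cap x y z n N i.+1 i.+1 i.+1 (f ^+ p * h ^+ q * z ^+ (i.+1 * n).+1).
Proof.
move=> le_ip; split.
- by apply: pow2_mull; apply/pow2_fh; apply: pow2_monomial.
- by apply: pow2_mull; apply: pow2_mulr; apply: pow2_form.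
- exact/pow2_mulr/pow2_varR.
- exact/pow2_mulr/pow2_varR.
Qed.

End PrescribedMembership.

(** * Degrees *)

Section Homogeneity.
Variables (K : fieldType).
Local Notation R := {mpoly K[3]}.
Implicit Types p q : R.

Lemma tdeg_homog d p : p != 0 -> p \is d.-homog -> tdeg p = d.
Proof. by move=> p0 pd; apply: (dhomog_uniq p0 _ pd); apply: dhomog_msize pd. Qed.

Lemma dhomog_var (i : 'I_3) : ('X_i : R) \is 1.-homog.
Proof. by rewrite dhomogX; apply/eqP; apply: mdeg1. Qed.

Lemma dhomog_exp d p e m : p \is d.-homog -> (d * m = e)%N -> p ^+ m \is e.-homog.
Proof. by move=> pd <-; apply: dhomogMn. Qed.

Lemma dhomog_varX (i : 'I_3) m : ('X_i : R) ^+ m \is m.-homog.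
Proof. by apply: dhomog_exp (dhomog_var i) _; rewrite mul1n. Qed.

Lemma dhomog_form (i j : 'I_3) n : ('X_i ^+ n - 'X_j ^+ n : R) \is n.-homog.
Proof. by rewrite dhomogD ?dhomogN ?dhomog_varX. Qed.

Lemma dhomog_sign d p m : p \is d.-homog -> (-1) ^+ m * p \is d.-homog.
Proof. by move=> pd; rewrite -signr_odd mulr_sign; case: (odd m); rewrite ?dhomogN. Qed.

Lemma pihomog_mul c d p q : p \is c.-homog ->
  pihomog mdeg d (p * q) = if (c <= d)%N then p * pihomog mdeg (d - c) q else 0.
Proof.
move=> pa; set k := maxn (msize q) d.+1.
have lek : (msize q <= k)%N by rewrite leq_maxl.
rewrite [in LHS](pihomog_partitionE (mf := mdeg) lek) mulr_sumr raddf_sum /=.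
have term (i : 'I_k) : pihomog mdeg d (p * pihomog mdeg i q) =
    if (c + i == d)%N then p * pihomog mdeg i q else 0.
  have hi : p * pihomog mdeg i q \is (c + i).-homog by apply: dhomogM pa _; apply: pihomogP.
  case: eqP => [<-|/eqP ne]; first exact: pihomog_dE.
  exact: pihomog_ne0 ne hi.
rewrite (eq_bigr _ (fun i _ => term i)); case: leqP => [le_ad|lt_da].
  have lt_k : (d - c < k)%N by rewrite leq_max ltnS leq_subr orbT.
  rewrite (bigD1 (Ordinal lt_k)) //= subnKC // eqxx big1 ?addr0 // => i ne_i.
  rewrite ifF //; apply/negP => /eqP aid; case/negP: ne_i; apply/eqP/val_inj => /=.
  by rewrite -aid addKn.
by rewrite big1 // => i _; rewrite ifF //; apply/negP => /eqP; lia.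
Qed.

(** Minimality of the resolution comes from this: all nonzero entries of X_j have positive
    degree. *)
Lemma dhomog_irrelevant e p : (0 < e)%N -> p \is e.-homog ->
  idl_seq [:: px K; py K; pz K] p.
Proof.
move=> e0 /dhomogP pe; rewrite [p]mpolyE.
have [I0 ID IM] := idl_gen_closed (fun i : 'I_3 => [:: px K; py K; pz K]`_i).
rewrite big_seq; elim/big_ind: _ => // m /pe /= mE.
have [i mi] : exists i, (0 < m i)%N.
  apply/existsP; apply: contraLR e0 => /existsPn m0.
  rewrite -mE mdegE big1 // => i _; apply/eqP.
  by rewrite -leqn0 leqNgt m0.
rewrite -mul_mpolyC; apply: (IM).
have -> : m = (U_(i) + (m - U_(i)))%MM.
  by rewrite addmC submK //; apply/mnm_lepP => j; rewrite mnm1E; case: eqP => [<-|].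
rewrite mpolyXD mulrC; apply: (IM).
have := idl_gen_mem (fun i : 'I_3 => [:: px K; py K; pz K]`_i) i.
by case: i {mi} => [[|[|[|//]]] lti] /=; congr (idl_gen _ 'X_ _); apply: val_inj.
Qed.

End Homogeneity.

Section ShiftLists.
Variables (n k : nat).
Local Notation t := (k * (n - 3))%N.

(** [F0shifts] arranged along the block recursion: a new block multiplies the old minors by a form
    of degree n and contributes n rows of a common degree. In [coldeg] the extra 1 is the degree of
    the linear entries of Z_j. *)
Fixpoint rowdeg j : seq nat :=
  if j is j'.+1 then map (addn n) (rowdeg j') ++ nseq n (n * (t + j + quo3 j + 1))%N
  else nseq t.+1 (n * t)%N.

Fixpoint coldeg j : seq nat :=
  if j is j'.+1 then map (addn n) (coldeg j') ++ nseq n (n * (t + j + quo3 j + 1) + 1)%N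
  else nseq t (n * (t + 1))%N.

Lemma size_rowdeg j : size (rowdeg j) = (Xdim n k j).+1.
Proof. by elim: j => [|j IH] /=; rewrite ?size_nseq // size_cat size_map size_nseq IH. Qed.

Lemma size_coldeg j : size (coldeg j) = Xdim n k j.
Proof. by elim: j => [|j IH] /=; rewrite ?size_nseq // size_cat size_map size_nseq IH. Qed.

Lemma leq_Xdim i j : (i <= j)%N -> (Xdim n k i <= Xdim n k j)%N.
Proof. by move=> le_ij; rewrite !XdimE leq_add2l leq_mul2r le_ij orbT. Qed.

Lemma quo3S j : (quo3 j <= quo3 j.+1)%N.
Proof. by rewrite /quo3 leq_div2r //; case: j. Qed.

Lemma nth_rowdegS j p : (p <= Xdim n k j)%N ->
  nth 0%N (rowdeg j.+1) p = (n + nth 0%N (rowdeg j) p)%N.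
Proof.
by move=> lep; rewrite /= nth_cat size_map size_rowdeg ltnS lep (nth_map 0%N) // size_rowdeg.
Qed.

Lemma rowdeg_top j p : (p <= t)%N -> nth 0%N (rowdeg j) p = (n * (t + j))%N.
Proof.
move=> lep; elim: j => [|j IH]; first by rewrite nth_nseq ltnS lep addn0.
rewrite nth_rowdegS ?IH; first by rewrite addnS mulnS.
by rewrite XdimE; apply: leq_trans lep (leq_addr _ _).
Qed.

(** Used to see that the entries of S_j with j at least 4 have positive degree. *)
Lemma rowdeg_bound j p : (p <= Xdim n k j)%N ->
  (nth 0%N (rowdeg j) p <= n * (t + j + quo3 j + 1))%N.
Proof.
elim: j p => [|j IH] p lep.
  by rewrite rowdeg_top // leq_mul2l addn0 -addnA leq_addr orbT.
have [lepj|ltpj] := leqP p (Xdim n k j).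
  rewrite nth_rowdegS //; apply: leq_trans (_ : n + n * (t + j + quo3 j + 1) <= _)%N.
    by rewrite leq_add2l IH.
  by rewrite -mulnS leq_mul2l; have := quo3S j; lia.
rewrite /= nth_cat size_map size_rowdeg ltnS (leqNgt p) ltpj /= nth_nseq.
by case: ifP.
Qed.

Lemma map_F0shifts j i r :
  map (addn n) (F0shifts n k j i r) = 
  nseq (t + 1) (n * (t + j.+1))%N
  ++ flatten [seq nseq (3 * n) (n * (t + j.+1 + l))%N | l <- iota 1 i]
  ++ nseq (r * n) (n * (t + j.+1 + i + 1))%N.
Proof.
rewrite /F0shifts !map_cat !map_nseq map_flatten -map_comp.
congr (nseq _ _ ++ (flatten _ ++ nseq _ _)).
- by rewrite -mulnS; congr muln; lia.
- by apply: eq_map => l /=; rewrite map_nseq -mulnS; congr (nseq _ (_ * _)%N); lia.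
- by rewrite -mulnS; congr muln; lia.
Qed.

Lemma map_F1shifts j i r :
  map (addn n) (F1shifts n k j i r) = 
  nseq t (n * (t + j.+1 + 1))%N
  ++ flatten [seq nseq (3 * n) (n * (t + j.+1 + l) + 1)%N | l <- iota 1 i]
  ++ nseq (r * n) (n * (t + j.+1 + i + 1) + 1)%N.
Proof.
rewrite /F1shifts !map_cat !map_nseq map_flatten -map_comp.
congr (nseq _ _ ++ (flatten _ ++ nseq _ _)).
- by rewrite -mulnS; congr muln; lia.
- by apply: eq_map => l /=; rewrite map_nseq addnA -mulnS; congr (nseq _ (_ * _ + _)%N); lia.
- by rewrite addnA -mulnS; congr (_ * _ + _)%N; lia.
Qed.

Lemma F0shifts_rot j i : F0shifts n k j i.+1 0 = F0shifts n k j i 3.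
Proof.
rewrite /F0shifts mul0n -[i.+1]addn1 iotaD map_cat flatten_cat /= !cats0.
by rewrite -!addnA [(i + 1)%N]addnC.
Qed.

Lemma F1shifts_rot j i : F1shifts n k j i.+1 0 = F1shifts n k j i 3.
Proof.
rewrite /F1shifts mul0n -[i.+1]addn1 iotaD map_cat flatten_cat /= !cats0.
by rewrite -!addnA [(i + 1)%N]addnC.
Qed.

Lemma shiftsE i r : (r <= 3)%N ->
  F0shifts n k (3 * i + r) i r = rowdeg (3 * i + r) /\
  F1shifts n k (3 * i + r) i r = coldeg (3 * i + r).
Proof.
have step i' r' : (r' < 3)%N ->
    F0shifts n k (3 * i' + r') i' r' = rowdeg (3 * i' + r') /\
    F1shifts n k (3 * i' + r') i' r' = coldeg (3 * i' + r') ->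
    F0shifts n k (3 * i' + r'.+1) i' r'.+1 = rowdeg (3 * i' + r'.+1) /\
    F1shifts n k (3 * i' + r'.+1) i' r'.+1 = coldeg (3 * i' + r'.+1).
  move=> lt_r [E0 E1]; rewrite !addnS /=.
  have -> : quo3 (3 * i' + r').+1 = i' by rewrite -addnS; case: (@quo3_rem3 i' r'.+1).
  rewrite -E0 -E1 map_F0shifts map_F1shifts /F0shifts /F1shifts -!catA -!nseqD.
  by rewrite -mulSnr.
elim: i r => [|i IHi]; elim=> [|r IHr] le_r; try exact/step/IHr/ltnW.
  by rewrite /F0shifts /F1shifts /= !cats0 !addn0 addn1.
by rewrite F0shifts_rot F1shifts_rot addn0 mulnS addnC; apply: IHi.
Qed.

End ShiftLists.

(** * The columns S_j *)

Section Main.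
Variables (n k : nat) (K : fieldType).
Hypotheses (hn : (3 <= n)%N) (hk : (1 <= k)%N).
Local Notation R := {mpoly K[3]}.
Local Notation x := (px K).
Local Notation y := (py K).
Local Notation z := (pz K).
Local Notation f := (pf K n).
Local Notation g := (pg K n).
Local Notation h := (ph K n).
Local Notation t := (k * (n - 3))%N.
Local Notation Xd := (Xdim n k).

Let xyz := pxyz_coordinates K.

Lemma n_gt1 : (1 < n)%N. Proof. by apply: leq_trans hn. Qed.

Definition dZ j : R := by3 (rem3 j) h f g.

Lemma rem3P (P : nat -> Prop) j : P 1%N -> P 2%N -> P 3%N -> P (rem3 j).
Proof.
move=> P1 P2 P3; rewrite /rem3; have := ltn_pmod j.-1 (isT : 0 < 3)%N.
by case: (_ %% 3)%N => [|[|[|//]]].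
Qed.

(** Merges the three residues of j into one generic block C(a,b) in rotated coordinates. *)
Lemma step_triple j : exists a b c : R,
  [/\ coordinates a b c, Zmx K n j = Cmx a b n, a ^+ n - b ^+ n = dZ j,
      a \is 1.-homog & b \is 1.-homog].
Proof.
rewrite /Zmx /dZ; elim/rem3P: (rem3 j).
- by exists x, y, z; split; [exact: xyz | | | exact: dhomog_var | exact: dhomog_var].
- exists y, z, x; split; [exact: coordinates_rot | | | exact: dhomog_var | exact: dhomog_var] => //.
- exists z, x, y; split; [do 2!apply: coordinates_rot; exact: xyz | | | exact: dhomog_var | exact: dhomog_var] => //.
Qed.

Lemma dZ_homog j : dZ j \is n.-homog.
Proof. by rewrite /dZ; elim/rem3P: (rem3 j); exact: dhomog_form. Qed.

Lemma dZ_neq0 j : dZ j != 0.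
Proof. by have [a [b [c [abc _ <- _ _]]]] := step_triple j; exact: (form_neq0 n_gt1 abc). Qed.

Variable S : Sfamily K n k.

(** Indexing by plain naturals allows minors of matrices of different sizes to be compared without
    casts; the value outside the range is 0. *)
Definition minor_at j p : R :=
  if (insub p : option 'I_(Xd j).+1) is Some q then sminors (Xmx S j) 0 q else 0.

Lemma minor_at_ord j (q : 'I_(Xd j).+1) : minor_at j q = sminors (Xmx S j) 0 q.
Proof. by rewrite /minor_at valK. Qed.

Definition col_val j : R := (sminors (Xmx S j) *m pad_top (Xd j).+1 (S j.+1)) 0 0.

Lemma sminors_Xmx j a b c : coordinates a b c -> Zmx K n j.+1 = Cmx a b n ->
  sminors (Xmx S j.+1) =
    row_mx ((a ^+ n - b ^+ n) *: sminors (Xmx S j)) (- col_val j *: monomial_row a b n).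
Proof. by move=> abc ZE; rewrite /= ZE; exact: (sminors_step n_gt1 abc). Qed.

Lemma minor_at_up j p : (p <= Xd j)%N -> minor_at j.+1 p = dZ j.+1 * minor_at j p.
Proof.
move=> lep; have [a [b [c [abc ZE <- _ _]]]] := step_triple j.+1.
have lt1 : (p < (Xd j).+1)%N by [].
have lt2 : (p < (Xd j.+1).+1)%N by rewrite /= (leq_trans lt1) // ltnS leq_addr.
rewrite -[p in LHS]/(val (Ordinal lt2)) minor_at_ord -[p in RHS]/(val (Ordinal lt1)) minor_at_ord.
rewrite (sminors_Xmx abc ZE) (_ : Ordinal lt2 = lshift n (Ordinal lt1)); last exact: val_inj.
by apply: etrans; [exact: row_mxEl | rewrite mxE].
Qed.

Lemma minor_at_low j q a b c : (q < n)%N -> coordinates a b c -> Zmx K n j.+1 = Cmx a b n ->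
  minor_at j.+1 ((Xd j).+1 + q) = - (col_val j * (a ^+ (n.-1 - q) * b ^+ q)).
Proof.
move=> ltq abc ZE.
have lt2 : ((Xd j).+1 + q < (Xd j.+1).+1)%N by rewrite /= addSn ltnS ltn_add2l.
rewrite -[((Xd j).+1 + q)%N]/(val (Ordinal lt2)) minor_at_ord (sminors_Xmx abc ZE).
rewrite (_ : Ordinal lt2 = rshift (Xd j).+1 (Ordinal ltq)); last exact: val_inj.
by apply: etrans; [exact: row_mxEr | rewrite !mxE mulNr].
Qed.

Lemma col_valE j l C (v : 'cV_(Xd l).+1) : (l <= j)%N ->
    (forall p, (p <= Xd l)%N -> minor_at j p = C * minor_at l p) ->
  (sminors (Xmx S j) *m pad_top (Xd j).+1 v) 0 0 = C * (sminors (Xmx S l) *m v) 0 0.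
Proof.
move=> le_lj H; apply: pad_topE => [|p q pq]; first by rewrite ltnS leq_Xdim.
by rewrite -!minor_at_ord pq; apply: H; rewrite -ltnS.
Qed.

(** The polynomial F of the recursion. For r = 3 the factors are ordered so that in all cases F is
    (b^n - c^n)^al (c^n - a^n)^be a^(in+1) for the rotated (a,b,c). *)
Definition Fspec i r : R := by3 r
  (f ^+ ((k - 1 - i) * (n - 3) + 2 * i + 1) * g ^+ ((i + 1) * (n - 2) - 1) * x ^+ (i * n).+1)
  (g ^+ ((k - 1 - i) * (n - 3) + 2 * i + 1) * h ^+ ((i + 1) * (n - 2)) * y ^+ (i * n).+1)
  (h ^+ ((k - 1 - i) * (n - 3) + 2 * i + 2) * f ^+ ((i + 1) * (n - 2)) * z ^+ (i * n).+1).

(** The first three clauses are al + be = k(n-3) + j for r = 1, 2, 3. The last is the bound i < be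
    needed when r is 2 or 3. *)
Lemma exponentsE i : (i < k)%N ->
  [/\ (k - 1 - i) * (n - 3) + 2 * i + 1 + ((i + 1) * (n - 2) - 1) = t + 3 * i + 1,
      (k - 1 - i) * (n - 3) + 2 * i + 1 + (i + 1) * (n - 2) = t + 3 * i + 2,
      (k - 1 - i) * (n - 3) + 2 * i + 2 + (i + 1) * (n - 2) = t + 3 * i + 3
    & i < (i + 1) * (n - 2)]%N.
Proof.
move=> lt_ik; have [n' ->] : exists n', n = (n' + 3)%N by exists (n - 3)%N; rewrite subnK.
have [k' ->] : exists k', k = (k' + i + 1)%N by exists (k - 1 - i)%N; lia.
have -> : (k' + i + 1 - 1 - i = k')%N by lia.
have -> : (n' + 3 - 3 = n')%N by lia.
have -> : (n' + 3 - 2 = n' + 1)%N by lia.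
by split; nia.
Qed.

Lemma Fspec_homog i r : (i < k)%N -> (1 <= r <= 3)%N ->
  Fspec i r != 0 /\ Fspec i r \is (n * (t + (3 * i + r) + i) + 1).-homog.
Proof.
move=> lt_ik /andP[r0 r3]; have [E1 E2 E3 _] := exponentsE lt_ik.
have [x0 y0 z0] : [/\ x != 0, y != 0 & z != 0] by split; exact: mpolyXU_neq0.
have f0 : f != 0 by exact: (form_neq0 n_gt1 (coordinates_rot xyz)).
have g0 : g != 0 by exact: (form_neq0 n_gt1 (coordinates_rot (coordinates_rot xyz))).
have h0 : h != 0 by exact: (form_neq0 n_gt1 xyz).
have fh : f \is n.-homog by exact: dhomog_form.
have gh : g \is n.-homog by exact: dhomog_form.
have hh : h \is n.-homog by exact: dhomog_form.
have hom (p q : R) (u : 'I_3) al be N : p \is n.-homog -> q \is n.-homog -> (al + be = N)%N ->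
    p ^+ al * q ^+ be * 'X_u ^+ (i * n).+1 \is (n * (N + i) + 1).-homog.
  move=> pn qn <-.
  have -> : (n * (al + be + i) + 1 = n * al + n * be + (i * n).+1)%N by lia.
  by apply: dhomogM (dhomog_varX _ _ _); apply: dhomogM; apply: dhomogMn.
rewrite (addnA t); case: r r0 r3 => [//|[|[|[|//]]]] _ _.
- split; last exact: hom fh gh E1.
  by apply: mulf_neq0; [apply: mulf_neq0|]; exact: expf_neq0.
- split; last exact: hom gh hh E2.
  by apply: mulf_neq0; [apply: mulf_neq0|]; exact: expf_neq0.
- split; last exact: hom hh fh E3.
  by apply: mulf_neq0; [apply: mulf_neq0|]; exact: expf_neq0.
Qed.

(** The two extra factors are the determinants of the blocks between X_(j-3) and X_(j-1), by which
    the minors met by [S_j] have been multiplied. *)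
Lemma Fspec_prescribed i r j : (0 < i)%N -> (1 <= r <= 3)%N -> j = (3 * i + r)%N ->
  Fspec i r = dZ j.-1 * dZ j.-2 * prescribed_det K n k i r.
Proof.
case: i => // i _ /andP[r0 r3] ->.
have e1 : (((i.+1 + 1) * (n - 2) - 1) = ((i.+1 + 1) * (n - 2) - 2).+1)%N by nia.
have e2 : ((i.+1 + 1) * (n - 2) = ((i.+1 + 1) * (n - 2) - 1).+1)%N by nia.
have rem3E i' r' : (1 <= r' <= 3)%N -> rem3 (3 * i' + r') = r' by move=> H; case: (quo3_rem3 i' H).
case: r r0 r3 => [//|[|[|[|//]]]] _ _.
- have -> : (3 * i.+1 + 1).-1 = (3 * i + 3)%N by lia.
  have -> : (3 * i + 3).-1 = (3 * i + 2)%N by lia.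
  rewrite /dZ !rem3E //= /Fspec /prescribed_det /= {1}e1 !addn1 !exprS; ring.
- have -> : (3 * i.+1 + 2).-1 = (3 * i.+1 + 1)%N by lia.
  have -> : (3 * i.+1 + 1).-1 = (3 * i + 3)%N by lia.
  rewrite /dZ !rem3E //= /Fspec /prescribed_det /= {1}e2 !addn1 !exprS; ring.
- have -> : (3 * i.+1 + 3).-1 = (3 * i.+1 + 2)%N by lia.
  have -> : (3 * i.+1 + 2).-1 = (3 * i.+1 + 1)%N by lia.
  rewrite /dZ !rem3E //= /Fspec /prescribed_det /= {1}e2 !addn1 addn2 !exprS; ring.
Qed.

Lemma sminors_X0 : sminors (Xmx S 0) = \row_p (f ^+ (t - p) * g ^+ p).
Proof. by apply: sminors_Hmx; exact: (form_neq0 n_gt1 (coordinates_rot xyz)). Qed.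

Lemma le_n3_t : (n - 3 <= t)%N.
Proof. by rewrite leq_pmull. Qed.

Lemma sumN : f + g = - h.
Proof. by rewrite /pf /pg /ph; ring. Qed.

Lemma sminors_S1 : (sminors (Xmx S 0) *m S1 K n k) 0 0 = (-1) ^+ t * Fspec 0 1.
Proof.
rewrite sminors_X0 (monomials_delta _ _ _ le_n3_t) /Fspec /=.
have -> : (t - (n - 3) = (k - 1 - 0) * (n - 3))%N by rewrite subn0 mulnBl mul1n.
have -> : ((0 + 1) * (n - 2) - 1 = n - 3)%N by lia.
have -> : ((k - 1 - 0) * (n - 3) + 2 * 0 + 1 = ((k - 1 - 0) * (n - 3)).+1)%N by lia.
by rewrite exprS; ring.
Qed.

(** The factor [h] is det Z_1, acquired on passing from X_0 to X_1. In [sminors_S3] the factor is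
    likewise det Z_1 det Z_2 = h f. *)
Lemma sminors_S2 : exists nu,
  h * (sminors (Xmx S 0) *m S2 K n k) 0 0 = (-1) ^+ nu * Fspec 0 2.
Proof.
(* The first summand is the sign built into [S2], the second comes from (f + g)^(n-3) =
   (-h)^(n-3). *)
exists ((k - 1) * (n - 3) + (n - 3))%N.
rewrite sminors_X0 (monomials_pad_bot _ _ _ le_n3_t) sumN (exprNn h) /Fspec /=.
have -> : (t - (n - 3) = (k - 1) * (n - 3))%N by rewrite mulnBl mul1n.
have -> : ((0 + 1) * (n - 2) = (n - 3).+1)%N by lia.
have -> : ((k - 1 - 0) * (n - 3) + 2 * 0 + 1 = ((k - 1) * (n - 3)).+1)%N by rewrite subn0; lia.
by rewrite exprD !exprS; ring.
Qed.

Lemma sminors_S3 : exists nu,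
  f * h * (sminors (Xmx S 0) *m S3 K n k) 0 0 = (-1) ^+ nu * Fspec 0 3.
Proof.
exists ((n - 3) + (k - 1) * (n - 3))%N.
have le_t : ((k - 1) * (n - 3) <= t)%N by rewrite leq_mul2r leq_subr orbT.
rewrite sminors_X0 (monomials_pad_top _ _ _ le_t) sumN (exprNn h) /Fspec /=.
have -> : (t - (k - 1) * (n - 3) = n - 3)%N.
  by rewrite -mulnBl subKn // mul1n.
have -> : ((0 + 1) * (n - 2) = (n - 3).+1)%N by lia.
have -> : ((k - 1 - 0) * (n - 3) + 2 * 0 + 2 = ((k - 1) * (n - 3)).+2)%N by rewrite subn0; lia.
by rewrite exprD !exprS; ring.
Qed.

Lemma minor_at_up2 j p : (p <= Xd j)%N ->
  minor_at j.+2 p = dZ j.+2 * dZ j.+1 * minor_at j p.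
Proof.
move=> lep; rewrite minor_at_up; first by rewrite minor_at_up // mulrA.
exact: leq_trans lep (leq_Xdim _ _ (leqnSn j)).
Qed.

Lemma signMK m (p : R) : (-1) ^+ m * ((-1) ^+ m * p) = p.
Proof. by rewrite mulrA -expr2 sqrr_sign mul1r. Qed.

Lemma col_val_spec m j i r : S_admissible m S -> (j < m)%N -> j.+1 = (3 * i + r)%N ->
  (1 <= r <= 3)%N -> exists nu, col_val j = (-1) ^+ nu * Fspec i r.
Proof.
move=> [E1 E2 E3 ES] lt_jm jE r13; case: i jE => [|i] jE.
  have rj : r = j.+1 by rewrite jE.
  move: r13; rewrite rj; case: j {lt_jm jE rj} => [|[|[|//]]] _.
  - exists t; rewrite /col_val (@col_valE 0 0 1) //; last by move=> p _; rewrite mul1r.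
    by rewrite mul1r E1 sminors_S1.
  - have [nu E] := sminors_S2; exists nu; rewrite -E /col_val E2.
    apply: (@col_valE 1 0 h) => // p lep; rewrite minor_at_up //.
  - have [nu E] := sminors_S3; exists nu; rewrite -E /col_val E3.
    apply: (@col_valE 2 0 (f * h)) => // p lep; rewrite minor_at_up2 //.
have j4 : (4 <= j.+1 <= m)%N by rewrite lt_jm andbT; case/andP: r13; lia.
have [_] := ES _ j4; rewrite det_adjoinE.
have [-> ->] : quo3 j.+1 = i.+1 /\ rem3 j.+1 = r by rewrite jE; apply: quo3_rem3.
move=> presc; exists (Xd (j.+1 - 3)).
(* The column with index j+1 is prescribed relative to X_l, two blocks below X_j. *)
have [l jl] : exists l, j = l.+2 by exists (j - 2)%N; lia.
have l3 : (j.+1 - 3 = l)%N by rewrite jl; lia.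
rewrite (Fspec_prescribed (j := j.+1)) // -presc [RHS]mulrCA signMK.
apply: col_valE; first by lia.
by rewrite l3 jl => p lep; rewrite minor_at_up2.
Qed.

End Main.

(** * Induction on j *)

Section Invariant.
Variables (n k : nat) (K : fieldType).
Hypotheses (hn : (3 <= n)%N) (hk : (1 <= k)%N).
Local Notation R := {mpoly K[3]}.
Local Notation x := (px K).
Local Notation y := (py K).
Local Notation z := (pz K).
Local Notation f := (pf K n).
Local Notation g := (pg K n).
Local Notation h := (ph K n).
Local Notation t := (k * (n - 3))%N.
Local Notation Xd := (Xdim n k).

Let xyz := pxyz_coordinates K.
Let n1 := n_gt1 hn.

Variable S : Sfamily K n k.

(** The three quotients count the blocks C(x,y), C(y,z) and C(z,x) among Z_1, ..., Z_j, which covers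
    all residues and j = 0 uniformly. *)
Definition minors_cap j : Prop := forall u, idl_minors (Xmx S j) u <->
  fermat_cap x y z n (t + j) ((j + 2) %/ 3) ((j + 1) %/ 3) (j %/ 3) u.

(** Nonvanishing is included because [S_allowed] measures minors by [tdeg], which gives the degree
    of nonzero polynomials only. *)
Definition minors_degree j : Prop := forall p, (p <= Xd j)%N ->
  minor_at S j p != 0 /\ minor_at S j p \is (nth 0%N (rowdeg n k j) p).-homog.

Lemma f_neq0 : f != 0. Proof. exact: (form_neq0 n1 (coordinates_rot xyz)). Qed.
Lemma g_neq0 : g != 0.
Proof. exact: (form_neq0 n1 (coordinates_rot (coordinates_rot xyz))). Qed.

Lemma hilbert_burch0 : hilbert_burch_exact (Xmx S 0).
Proof.
apply: hilbert_burch_Hmx; [exact: f_neq0 | exact: g_neq0 |] => v w E.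
apply: (divides_d_opposite_form n1 (coordinates_rot xyz)); exists w; exact: E.
Qed.

Lemma minors_cap0 : minors_cap 0.
Proof.
have fg u : idl_minors (Xmx S 0) u <-> pow2 f g t u.
  rewrite idl_minorsE sminors_X0 //; split=> [[v ->]|[w ->]].
    exists (fun p => v p 0); rewrite mxE; apply: eq_bigr => p _.
    by rewrite mxE mulrC.
  exists (\col_p w p); rewrite mxE; apply: eq_bigr => p _.
  by rewrite !mxE mulrC.
move=> u; rewrite fg addn0; split=> [H|[H _ _ _]]; last exact: H.
by split; [exact: H | exact: pow2_0 | exact: pow2_0 | exact: pow2_0].
Qed.

Lemma minors_degree0 : minors_degree 0.
Proof.
move=> p lep; have ltp : (p < (Xd 0).+1)%N by [].
have -> : minor_at S 0 p = f ^+ (t - p) * g ^+ p.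
  by rewrite -[p in LHS]/(val (Ordinal ltp)) minor_at_ord sminors_X0 // mxE.
split; first by apply: mulf_neq0; apply: expf_neq0; [exact: f_neq0 | exact: g_neq0].
rewrite rowdeg_top // addn0.
have -> : (n * t = n * (t - p) + n * p)%N by rewrite -mulnDr subnK.
by apply: dhomogM; apply: dhomogMn; exact: dhomog_form.
Qed.

Variables (j i r nu : nat).
Hypotheses (jE : j.+1 = (3 * i + r)%N) (r13 : (1 <= r <= 3)%N) (lt_ik : (i < k)%N).
Hypothesis cE : col_val S j = (-1) ^+ nu * Fspec n k K i r.

Lemma rem3_j : rem3 j.+1 = r. Proof. by rewrite jE; case: (quo3_rem3 i r13). Qed.
Lemma quo3_j : quo3 j.+1 = i. Proof. by rewrite jE; case: (quo3_rem3 i r13). Qed.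

Lemma minors_degree_step : minors_degree j -> minors_degree j.+1.
Proof.
move=> Hj p lep; have [lepj|ltjp] := leqP p (Xd j).
  have [m0 mh] := Hj p lepj.
  rewrite minor_at_up // nth_rowdegS //; split; last exact: dhomogM (dZ_homog _ _ _) mh.
  by apply: mulf_neq0 => //; exact: dZ_neq0.
have [q pE] : exists q, p = ((Xd j).+1 + q)%N by exists (p - (Xd j).+1)%N; rewrite subnKC.
have ltq : (q < n)%N by move: lep; rewrite pE /= addSn ltn_add2l.
have [a [b [c [abc ZE _ ah bh]]]] := step_triple n K j.+1.
have [a0 b0] : a != 0 /\ b != 0 by case: abc => _ _ _ _ [].
have [F0 Fh] := Fspec_homog K hn hk lt_ik r13.
(* The new row degree is split as the degree of F plus n-1, the degree of the monomials in the new
   minors. *)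
have -> : nth 0%N (rowdeg n k j.+1) p = (n * (t + j.+1 + i) + 1 + n.-1)%N.
  rewrite /= nth_cat size_map size_rowdeg pE ltnNge leq_addr /= nth_nseq addKn ltq quo3_j.
  by move: ltq; clear; nia.
rewrite pE (minor_at_low hn S ltq abc ZE) cE oppr_eq0 dhomogN jE; split.
  by rewrite !mulf_neq0 ?expf_neq0 ?oppr_eq0 ?oner_eq0.
apply: dhomogM; first exact: dhomog_sign.
have -> : n.-1 = (1 * (n.-1 - q) + 1 * q)%N by rewrite !mul1n subnK // -ltnS (ltn_predK ltq).
have -> : (1 * (n.-1 - q) + 1 * q - q = n.-1 - q)%N by lia.
by apply: dhomogM; apply: dhomogMn.
Qed.

Lemma Xmx_step (P : forall m, 'M[R]_(m.+1, m) -> Prop) a b : Zmx K n j.+1 = Cmx a b n ->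
  P _ (block_mx (Xmx S j) (pad_corner (Xd j).+1 n (S j.+1)) 0 (Cmx a b n) : 'M_((Xd j + n).+1, Xd j + n)) ->
  P _ (Xmx S j.+1).
Proof. by move=> ZE; rewrite /= ZE. Qed.

Lemma step_data : exists a b c, exists al be, [/\ coordinates a b c, Zmx K n j.+1 = Cmx a b n,
  (al + be = (t + j).+1)%N &
  [/\ a ^+ n - b ^+ n = by3 r h f g,
      Fspec n k K i r = (b ^+ n - c ^+ n) ^+ al * (c ^+ n - a ^+ n) ^+ be * a ^+ (i * n).+1
    & (a, b) = by3 r (x, y) (y, z) (z, x)]].
Proof.
have [E1 E2 E3 _] := exponentsE hn hk lt_ik.
have Z : Zmx K n j.+1 = by3 r (Cmx x y n) (Cmx y z n) (Cmx z x n) by rewrite /Zmx rem3_j.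
rewrite Z -addnS jE addnA; case: r r13 => [//|[|[|[|//]]]] _.
- exists x, y, z; do 2!eexists; split; [exact: xyz | by [] | exact: E1 | split; reflexivity].
- exists y, z, x; do 2!eexists; split; [exact: coordinates_rot | by [] | exact: E2 | split; reflexivity].
- exists z, x, y; do 2!eexists; split; [do 2!apply: coordinates_rot; exact: xyz | by [] | exact: E3 | split; reflexivity].
Qed.

Lemma hilbert_burch_Xstep : hilbert_burch_exact (Xmx S j) -> hilbert_burch_exact (Xmx S j.+1).
Proof.
move=> HB; have [a [b [c [al [be [abc ZE Nab [_ FE _]]]]]]] := step_data.
apply: (Xmx_step (P := fun m M => hilbert_burch_exact M) ZE).
apply: (hilbert_burch_step n1 abc Nab _ HB (mm := i * n) (nu := nu)).
by rewrite -FE; exact: cE.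
Qed.

Lemma idl_minors_Xstep u : exists a b, [/\ (a, b) = by3 r (x, y) (y, z) (z, x) &
  idl_minors (Xmx S j.+1) u <->
  exists v w, [/\ idl_minors (Xmx S j) v, pow2 a b n.-1 w & u = by3 r h f g * v + Fspec n k K i r * w]].
Proof.
have [a [b [c [al [be [abc ZE Nab [dE FE abE]]]]]]] := step_data.
exists a, b; split; first exact: abE.
apply: (Xmx_step (P := fun m M => idl_minors M u <-> _) ZE).
rewrite -dE FE; apply: (idl_minors_step n1 abc (nu := nu)).
by rewrite -FE; exact: cE.
Qed.

Lemma minors_cap_step : minors_cap j -> minors_cap j.+1.
Proof.
have [E1 E2 E3 lt_be] := exponentsE hn hk lt_ik.
have Nj : (t + j).+1 = (t + (3 * i + r))%N by rewrite -addnS jE.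
have le_al : (i <= (k - 1 - i) * (n - 3) + 2 * i + 1)%N.
  by move: ((k - 1 - i) * (n - 3))%N => A; lia.
have lt_al : (i < (k - 1 - i) * (n - 3) + 2 * i + 2)%N.
  by move: ((k - 1 - i) * (n - 3))%N => A; lia.
have Z : Zmx K n j.+1 = by3 r (Cmx x y n) (Cmx y z n) (Cmx z x n) by rewrite /Zmx rem3_j.
move=> Hj u; rewrite addnS.
move: jE cE Z Nj; rewrite addnA; case: r r13 => [//|[|[|[|//]]]] _ jE' cE' Z Nj.
- have -> : ((j.+1 + 2) %/ 3 = i.+1)%N by lia.
  have -> : ((j.+1 + 1) %/ 3 = i)%N by lia.
  have -> : (j.+1 %/ 3 = i)%N by lia.
  apply: (Xmx_step (P := fun m M => idl_minors M u <-> _) Z).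
  apply: (fermat_step1 n1 xyz (etrans E1 (esym Nj)) le_al cE') => w.
  rewrite (Hj w); have -> : ((j + 2) %/ 3 = i)%N by lia.
  have -> : ((j + 1) %/ 3 = i)%N by lia.
  by have -> : (j %/ 3 = i)%N by lia.
- have -> : ((j.+1 + 2) %/ 3 = i.+1)%N by lia.
  have -> : ((j.+1 + 1) %/ 3 = i.+1)%N by lia.
  have -> : (j.+1 %/ 3 = i)%N by lia.
  apply: (Xmx_step (P := fun m M => idl_minors M u <-> _) Z).
  apply: (fermat_step2 n1 xyz (etrans E2 (esym Nj)) le_al lt_be cE') => w.
  rewrite (Hj w); have -> : ((j + 2) %/ 3 = i.+1)%N by lia.
  have -> : ((j + 1) %/ 3 = i)%N by lia.
  by have -> : (j %/ 3 = i)%N by lia.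
- have -> : ((j.+1 + 2) %/ 3 = i.+1)%N by lia.
  have -> : ((j.+1 + 1) %/ 3 = i.+1)%N by lia.
  have -> : (j.+1 %/ 3 = i.+1)%N by lia.
  apply: (Xmx_step (P := fun m M => idl_minors M u <-> _) Z).
  apply: (fermat_step3 n1 xyz (etrans E3 (esym Nj)) lt_al lt_be cE') => w.
  rewrite (Hj w); have -> : ((j + 2) %/ 3 = i.+1)%N by lia.
  have -> : ((j + 1) %/ 3 = i.+1)%N by lia.
  by have -> : (j %/ 3 = i)%N by lia.
Qed.

End Invariant.

(** * Graded structure of X_j *)

Section Conclusion.
Variables (n k : nat) (K : fieldType).
Hypotheses (hn : (3 <= n)%N) (hk : (1 <= k)%N).
Local Notation R := {mpoly K[3]}.
Local Notation x := (px K).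
Local Notation y := (py K).
Local Notation z := (pz K).
Local Notation f := (pf K n).
Local Notation g := (pg K n).
Local Notation h := (ph K n).
Local Notation t := (k * (n - 3))%N.
Local Notation Xd := (Xdim n k).

Lemma quo_rem3 j : j.+1 = (3 * (j %/ 3) + (j %% 3).+1)%N /\ (1 <= (j %% 3).+1 <= 3)%N.
Proof. by rewrite addnS mulnC -divn_eq ltn_pmod. Qed.

Lemma Xmx_invariant m (S : Sfamily K n k) j : S_admissible m S -> (j <= m)%N -> (j <= 3 * k)%N ->
  [/\ hilbert_burch_exact (Xmx S j), minors_cap S j & minors_degree S j].
Proof.
move=> Sm; elim: j => [_ _|j IH lejm lejk].
  by split; [exact: hilbert_burch0 | exact: minors_cap0 | exact: minors_degree0].
have [HB HC HD] := IH (ltnW lejm) (ltnW lejk).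
have [jE r13] := quo_rem3 j.
have lt_ik : (j %/ 3 < k)%N by rewrite ltn_divLR // mulnC.
have [nu cE] := col_val_spec hn hk Sm lejm jE r13.
split.
- exact: (hilbert_burch_Xstep hn hk jE r13 lt_ik cE HB).
- exact: (minors_cap_step hn hk jE r13 lt_ik cE HC).
- exact: (minors_degree_step hn hk jE r13 lt_ik cE HD).
Qed.

(** The degree is that of [Fspec i r] lowered by 2n, for the two forms removed from it. *)
Lemma prescribed_homog i r : (0 < i < k)%N -> (1 <= r <= 3)%N ->
  prescribed_det K n k i r != 0 /\
  prescribed_det K n k i r \is (n * (t + (3 * i + r) + i - 2) + 1).-homog.
Proof.
move=> /andP[i0 lt_ik] /andP[r0 r3]; have [E1 E2 E3 _] := exponentsE hn hk lt_ik.
have ge2 : (2 <= (i + 1) * (n - 2))%N by nia.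
have xyz := pxyz_coordinates K; have n1 := n_gt1 hn.
have [x0 y0 z0] : [/\ x != 0, y != 0 & z != 0] by split; exact: mpolyXU_neq0.
have f0 : f != 0 by exact: f_neq0.
have g0 : g != 0 by exact: g_neq0.
have h0 : h != 0 by exact: (form_neq0 n1 xyz).
have fh : f \is n.-homog by exact: dhomog_form.
have gh : g \is n.-homog by exact: dhomog_form.
have hh : h \is n.-homog by exact: dhomog_form.
have hom (p q : R) (u : 'I_3) al be N : p \is n.-homog -> q \is n.-homog -> p != 0 -> q != 0 ->
    (al + be = N)%N ->
    p ^+ al * q ^+ be * 'X_u ^+ (i * n + 1) != 0 /\
    p ^+ al * q ^+ be * 'X_u ^+ (i * n + 1) \is (n * (N + i) + 1).-homog.
  move=> pn qn p0 q0 <-; split.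
    by apply: mulf_neq0; [apply: mulf_neq0|]; apply: expf_neq0 => //; exact: mpolyXU_neq0.
  have -> : (n * (al + be + i) + 1 = n * al + n * be + (i * n + 1))%N.
    by rewrite !mulnDr [(n * i)%N]mulnC addnA.
  by apply: dhomogM (dhomog_varX _ _ _); apply: dhomogM; apply: dhomogMn.
have -> : (t + (3 * i + r) + i - 2 = t + 3 * i + r - 2 + i)%N by move: i0; clear; lia.
rewrite /prescribed_det; case: r r0 r3 => [//|[|[|[|//]]]] _ _.
- by apply: hom => //; move: ge2 E1; move: ((i + 1) * (n - 2))%N ((k - 1 - i) * (n - 3))%N (t + 3 * i)%N; clear; lia.
- by apply: hom => //; move: ge2 E2; move: ((i + 1) * (n - 2))%N ((k - 1 - i) * (n - 3))%N (t + 3 * i)%N; clear; lia.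
- by apply: hom => //; move: ge2 E3; move: ((i + 1) * (n - 2))%N ((k - 1 - i) * (n - 3))%N (t + 3 * i)%N; clear; lia.
Qed.

Lemma S1_homog p : S1 K n k p 0 \is (n + 1).-homog.
Proof.
rewrite 2!mxE mulr_natr; apply: rpredMn; rewrite -mulrA addnC; apply: dhomog_sign.
by apply: dhomogM; [exact: dhomog_var | exact: dhomog_form].
Qed.

Lemma S2_homog p : S2 K n k p 0 \is (n + 1).-homog.
Proof.
rewrite mxE; case: ifP => _; last exact: dhomog0.
case: insub => [q|]; last exact: dhomog0.
rewrite 2!mxE mulr_natr; apply: rpredMn; rewrite -mulrA addnC; apply: dhomog_sign.
by apply: dhomogM; [exact: dhomog_var | exact: dhomog_form].
Qed.

Lemma S3_homog p : S3 K n k p 0 \is (n + 1).-homog.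
Proof.
rewrite mxE; case: insub => [q|]; last exact: dhomog0.
rewrite 2!mxE mulr_natr; apply: rpredMn; rewrite -mulrA addnC; apply: dhomog_sign.
by apply: dhomogM; [exact: dhomog_var | exact: dhomog_form].
Qed.

(** Strengthens [graded_mx] by positive degrees, so one induction yields both the grading and
    minimality. *)
Definition positively_graded m l (a b : seq nat) (M : 'M[R]_(m, l)) : Prop :=
  forall p q, M p q = 0 \/
    exists2 e, (0 < e)%N & (nth 0 a p + e = nth 0 b q)%N /\ M p q \is e.-homog.

Lemma minor_tdeg (S : Sfamily K n k) l (q : 'I_(Xd l).+1) : minors_degree S l ->
  tdeg (\det (row' q (Xmx S l))) = nth 0%N (rowdeg n k l) q.
Proof.
move=> HD; have leq_q : (q <= Xd l)%N by rewrite -ltnS.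
have [] := HD q leq_q; rewrite minor_at_ord mxE => d0 dh.
apply: tdeg_homog; first by apply: contraNneq d0 => ->; rewrite mulr0.
by rewrite -(signMK q (\det _)); apply: dhomog_sign.
Qed.

(** The entries of S_1, S_2, S_3 have degree n+1. For later columns, the row degrees rise by 3n from
    X_(j-3) to X_j while the prescribed degree lies 3n below the new column degree, so the two
    shifts cancel. *)
Lemma S_column_graded m (S : Sfamily K n k) j (p : 'I_(Xd (j.+1 - 3)).+1) :
  S_admissible m S -> (j.+1 <= m)%N -> (j.+1 <= 3 * k)%N ->
  S j.+1 p 0 = 0 \/
  exists2 e, (0 < e)%N &
    (nth 0 (rowdeg n k j.+1) p + e = n * (t + j.+1 + quo3 j.+1 + 1) + 1)%N /\ S j.+1 p 0 \is e.-homog.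
Proof.
move=> Sm lejm lejk; have [lt_j3|ge_j3] := ltnP j 3.
  right; exists (n + 1)%N; first by rewrite addn1.
  have [E1 E2 E3 _] := Sm.
  split.
    rewrite rowdeg_top; first by rewrite /quo3 /= divn_small // addn0; lia.
    have -> : t = Xd (j.+1 - 3) by rewrite (_ : (j.+1 - 3 = 0)%N) //; apply/eqP; rewrite subn_eq0.
    by rewrite -ltnS.
  case: j lt_j3 p {lejm lejk} => [|[|[|//]]] _ p.
  - rewrite E1; exact: S1_homog.
  - rewrite E2; exact: S2_homog.
  - rewrite E3; exact: S3_homog.
have [_ _ _ ES] := Sm.
have j4 : (4 <= j.+1 <= m)%N by rewrite ltnS ge_j3.
have [Sp _] := ES _ j4; case: (Sp p) => [->|[e De eh]]; [by left | right].
have [jE r13] := quo_rem3 j.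
have [qE rE] : quo3 j.+1 = (j %/ 3)%N /\ rem3 j.+1 = (j %% 3).+1 by rewrite jE; apply: quo3_rem3.
have i0k : (0 < j %/ 3 < k)%N by rewrite divn_gt0 // ge_j3 ltn_divLR // mulnC.
have [P0 Ph] := prescribed_homog i0k r13.
have [_ _ HD] : [/\ hilbert_burch_exact (Xmx S (j.+1 - 3)), minors_cap S (j.+1 - 3) & minors_degree S (j.+1 - 3)].
  by apply: Xmx_invariant Sm _ _; apply: leq_trans (leq_subr _ _) _.
move: De; rewrite qE rE (tdeg_homog P0 Ph) (minor_tdeg p HD) -jE => De.
have lep : (p <= Xd (j.+1 - 3))%N by rewrite -ltnS.
have row3 : nth 0%N (rowdeg n k j.+1) p = (n + (n + (n + nth 0%N (rowdeg n k (j.+1 - 3)) p)))%N.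
  have -> : rowdeg n k j.+1 = rowdeg n k (j.+1 - 3).+3 by congr rowdeg; lia.
  rewrite !nth_rowdegS //; apply: leq_trans lep (leq_Xdim _ _ _); lia.
have := rowdeg_bound lep.
have -> : quo3 (j.+1 - 3) = ((j %/ 3) - 1)%N.
  by rewrite /quo3; lia.
move: (nth _ _ _) De row3 => A De row3 bA.
exists e; last by split=> //; rewrite row3 -addnA -addnA -addnA De; nia.
have bA' : (A <= n * (t + j.+1 + j %/ 3 - 2))%N.
  by apply: leq_trans bA _; rewrite leq_mul2l; apply/orP; right; lia.
by lia.
Qed.

Lemma nth_coldegS j q : (q < Xd j)%N ->
  nth 0%N (coldeg n k j.+1) q = (n + nth 0%N (coldeg n k j) q)%N.
Proof.
by move=> ltq; rewrite /= nth_cat size_map size_coldeg ltq (nth_map 0%N) // size_coldeg.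
Qed.

Lemma Xmx_graded m (S : Sfamily K n k) j : S_admissible m S -> (j <= m)%N -> (j <= 3 * k)%N ->
  positively_graded (rowdeg n k j) (coldeg n k j) (Xmx S j).
Proof.
move=> Sm; elim: j => [_ _|j IH lejm lejk] p q.
  have lep : (p <= t)%N by rewrite -ltnS.
  rewrite rowdeg_top // addn0 nth_nseq ltn_ord mxE.
  case: ifP => _; last case: ifP => _; last by left.
    right; exists n; first by apply: leq_trans hn.
    by split; [rewrite mulnDr muln1 | rewrite dhomogN; exact: dhomog_form].
  right; exists n; first by apply: leq_trans hn.
  by split; [rewrite mulnDr muln1 | exact: dhomog_form].
suff H (p' : 'I_((Xd j).+1 + n)) (q' : 'I_(Xd j + n)) :
    let M := block_mx (Xmx S j) (pad_corner (Xd j).+1 n (S j.+1)) 0 (Zmx K n j.+1) in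
    M p' q' = 0 \/ exists2 e, (0 < e)%N &
      (nth 0 (rowdeg n k j.+1) p' + e = nth 0 (coldeg n k j.+1) q')%N /\ M p' q' \is e.-homog.
  exact: H.
move=> M; rewrite /M; case: (split_ordP p') => {}p' ->; case: (split_ordP q') => {}q' ->.
- rewrite block_mxEul; have := IH (ltnW lejm) (ltnW lejk) p' q'.
  case=> [->|[e e0 [de eh]]]; [by left | right; exists e => //; split=> //].
  have lep' : (p' <= Xd j)%N by rewrite -ltnS.
  by rewrite (nth_rowdegS lep') (nth_coldegS (ltn_ord q')) -addnA; congr (n + _)%N.
- rewrite block_mxEur mxE; case: ifP => _; last by left.
  rewrite mxE; case: insubP => [p'' _ pE|_]; last by left.
  have := S_column_graded p'' Sm lejm lejk; rewrite pE.
  case=> [->|[e e0 [de eh]]]; [by left | right; exists e => //; split=> //].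
  rewrite de /= nth_cat size_map size_coldeg ltnNge leq_addr /= addKn nth_nseq ltn_ord.
  by [].
- by rewrite block_mxEdl mxE; left.
- rewrite block_mxEdr.
  have -> : nth 0%N (rowdeg n k j.+1) (rshift (Xd j).+1 p') = (n * (t + j.+1 + quo3 j.+1 + 1))%N.
    by rewrite /= nth_cat size_map size_rowdeg ltnNge leq_addr /= addKn nth_nseq ltn_ord.
  have -> : nth 0%N (coldeg n k j.+1) (rshift (Xd j) q') = (n * (t + j.+1 + quo3 j.+1 + 1) + 1)%N.
    by rewrite /= nth_cat size_map size_coldeg ltnNge leq_addr /= addKn nth_nseq ltn_ord.
  have [a [b [c [_ -> _ ah bh]]]] := step_triple n K j.+1.
  rewrite mxE; case: ifP => _; first by right; exists 1%N.
  case: ifP => _; first by right; exists 1%N => //; rewrite dhomogN.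
  case: ifP => _; first by right; exists 1%N => //; rewrite dhomogN.
  by left.
Qed.

End Conclusion.

(** * Existence of S_j and the resolution *)

Section Final.
Variables (n k : nat) (K : fieldType).
Hypotheses (hn : (3 <= n)%N) (hk : (1 <= k)%N).
Local Notation R := {mpoly K[3]}.
Local Notation x := (px K).
Local Notation y := (py K).
Local Notation z := (pz K).
Local Notation f := (pf K n).
Local Notation g := (pg K n).
Local Notation h := (ph K n).
Local Notation t := (k * (n - 3))%N.
Local Notation Xd := (Xdim n k).

Lemma homog_preimage m (a : seq nat) (e : 'rV[R]_m) (u : 'cV[R]_m) (D : R) d :
    (forall p, e 0 p \is (nth 0%N a p).-homog) -> D \is d.-homog -> D = (e *m u) 0 0 ->
  exists s : 'cV[R]_m, D = (e *m s) 0 0 /\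
    forall p, s p 0 = 0 \/ exists2 c, (nth 0%N a p + c = d)%N & s p 0 \is c.-homog.
Proof.
move=> eh Dh DE.
(* Each coefficient keeps only its component of complementary degree. If a_p exceeds d, that term
   has no part in degree d, hence the default 0. *)
exists (\col_p if (nth 0%N a p <= d)%N then pihomog mdeg (d - nth 0%N a p) (u p 0) else 0); split.
  rewrite -(pihomog_dE Dh) [in LHS]DE !mxE raddf_sum; apply: eq_bigr => p _.
  by rewrite mxE /= (pihomog_mul _ _ (eh p)); case: ifP; rewrite ?mulr0.
move=> p; rewrite mxE; case: ifP => [le_d|_]; last by left.
right; exists (d - nth 0%N a p)%N; [by rewrite subnKC | exact: pihomogP].
Qed.

Lemma prescribed_in_minors m (S : Sfamily K n k) l i r :
    S_admissible m S -> (l <= m)%N -> l = (3 * i + r)%N -> (1 <= r <= 3)%N -> (i.+1 < k)%N ->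
  idl_minors (Xmx S l) (prescribed_det K n k i.+1 r).
Proof.
move=> Sm lelm lE r13 lt_ik; have lelk : (l <= 3 * k)%N by move: lE r13 lt_ik; clear; lia.
have [_ HC _] := Xmx_invariant hn hk Sm lelm lelk.
have [E1 E2 E3 _] := exponentsE hn hk lt_ik.
have ge2 : (2 <= (i.+1 + 1) * (n - 2))%N by rewrite -[2%N]muln1 leq_mul ?addn1 // subn_gt0.
apply/(HC _); move: E1 E2 E3 ge2; rewrite lE /prescribed_det (addn1 (i.+1 * n)).
set A := ((k - 1 - i.+1) * (n - 3))%N; set B := ((i.+1 + 1) * (n - 2))%N => E1 E2 E3 ge2; clearbody A B.
move: r13 {lE}; case: r => [//|[|[|[|//]]]] _ /=.
- have -> : ((3 * i + 1 + 2) %/ 3 = i.+1)%N by clear; lia.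
  have -> : ((3 * i + 1 + 1) %/ 3 = i)%N by clear; lia.
  have -> : ((3 * i + 1) %/ 3 = i)%N by clear; lia.
  by apply: prescribed_cap1; move: E1 ge2; clear; lia.
- have -> : ((3 * i + 2 + 2) %/ 3 = i.+1)%N by clear; lia.
  have -> : ((3 * i + 2 + 1) %/ 3 = i.+1)%N by clear; lia.
  have -> : ((3 * i + 2) %/ 3 = i)%N by clear; lia.
  by apply: prescribed_cap2; move: E2 ge2; clear; lia.
- have -> : ((3 * i + 3 + 2) %/ 3 = i.+1)%N by clear; lia.
  have -> : ((3 * i + 3 + 1) %/ 3 = i.+1)%N by clear; lia.
  have -> : ((3 * i + 3) %/ 3 = i.+1)%N by clear; lia.
  by apply: prescribed_cap3; move: E3 ge2; clear; lia.
Qed.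

Lemma S_exists j (S : Sfamily K n k) : (4 <= j <= 3 * k)%N -> S_admissible (j - 1) S ->
  exists s, S_allowed S j s.
Proof.
move=> /andP[j4 jk] Sm.
case: j j4 jk Sm => [//|j] j4 jk Sm; have [jE r13] := quo_rem3 j.
set i := (j %/ 3)%N in jE; set r := (j %% 3).+1 in jE r13.
have [qE rE] : quo3 j.+1 = i /\ rem3 j.+1 = r by rewrite jE; apply: quo3_rem3.
have i0 : (0 < i)%N by rewrite /i divn_gt0.
have lt_ik : (i < k)%N by rewrite /i ltn_divLR // mulnC.
have lelm : (j.+1 - 3 <= j.+1 - 1)%N by rewrite leq_sub2l.
have lelk : (j.+1 - 3 <= 3 * k)%N by apply: leq_trans (leq_subr _ _) jk.
have [_ _ HD] := Xmx_invariant hn hk Sm lelm lelk.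
have i0k : (0 < i < k)%N by rewrite i0.
have [P0 Ph] := prescribed_homog K hn hk i0k r13.
have : idl_minors (Xmx S (j.+1 - 3)) (prescribed_det K n k i r).
  have iE : i = i.-1.+1 by rewrite prednK.
  rewrite iE; apply: (prescribed_in_minors Sm lelm) => //; last by rewrite -iE.
  by rewrite jE; move: i0; clear; lia.
case/idl_minorsE => u uE.
have minorh (p : 'I_(Xd (j.+1 - 3)).+1) : sminors (Xmx S (j.+1 - 3)) 0 p
    \is (nth 0%N (rowdeg n k (j.+1 - 3)) p).-homog.
  by have [|_] := HD p; rewrite ?minor_at_ord // -ltnS.
have [s [sE sh]] := homog_preimage minorh Ph uE.
(* Compensates the sign between the pairing with [sminors] and [det_adjoin]. *)
exists ((-1) ^+ Xd (j.+1 - 3) *: s); split=> [p|].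
  rewrite mxE qE rE (minor_tdeg p HD) (tdeg_homog P0 Ph).
  case: (sh p) => [->|[c cE ch]]; [by left; rewrite mulr0 | right].
  by exists c => //; exact: dhomog_sign.
rewrite det_adjoinE qE rE -scalemxAr mxE -sE; exact: signMK.
Qed.

Lemma Xmx_resolution m (S : Sfamily K n k) j i r : S_admissible m S -> (j <= m)%N -> (j <= 3 * k)%N ->
    j = (3 * i + r)%N -> (r <= 3)%N ->
  min_graded_free_res (F1shifts n k j i r) (F0shifts n k j i r) (Xmx S j) (idl_minors (Xmx S j)).
Proof.
move=> Sm lejm lejk jE r3.
have [-> ->] : F0shifts n k j i r = rowdeg n k j /\ F1shifts n k j i r = coldeg n k j.
  by rewrite jE; apply: shiftsE.
have [[HBi HBe] _ HD] := Xmx_invariant hn hk Sm lejm lejk.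
have HG := Xmx_graded hn hk Sm lejm lejk.
split; [exact: size_coldeg | exact: size_rowdeg | | |].
- move=> p q; case: (HG p q) => [->|[e _ [de eh]]]; [by left | right; by exists e].
- move=> p q; case: (HG p q) => [->|[e e0 [_ eh]]]; last exact: dhomog_irrelevant e0 eh.
  by case: (idl_gen_closed (fun i : 'I_3 => [:: px K; py K; pz K]`_i)).
exists (sminors (Xmx S j)); split.
- move=> p q; right; exists (nth 0%N (rowdeg n k j) q); first by rewrite ord1 add0n.
  have [|_] := HD q; first by rewrite -ltnS.
  by rewrite minor_at_ord ord1.
- exact: HBi.
- move=> u; split; first exact: HBe.
  by case=> v ->; rewrite mulmxA sminors_mul mul0mx.
- exact: idl_minorsE.
Qed.

Lemma Xmx_recursion m (S : Sfamily K n k) j i r u :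
    S_admissible m S -> (j < m)%N -> (j < 3 * k)%N -> j.+1 = (3 * i + r)%N -> (1 <= r <= 3)%N ->
  idl_minors (Xmx S j.+1) u <-> exists v w, [/\ idl_minors (Xmx S j) v,
    by3 r (pow2 x y n.-1 w) (pow2 y z n.-1 w) (pow2 z x n.-1 w) &
    u = by3 r h f g * v + Fspec n k K i r * w].
Proof.
move=> Sm lejm lejk jE r13.
have lt_ik : (i < k)%N by move: lejk jE r13; clear; lia.
have [nu cE] := col_val_spec hn hk Sm lejm jE r13.
have [a [b [abE ->]]] := idl_minors_Xstep hn hk jE r13 lt_ik cE u.
move: r13 abE {jE cE}; case: r => [//|[|[|[|//]]]] _ [-> ->]; reflexivity.
Qed.

End Final.

Lemma idl_add_scale (A : comNzRingType) (I J : A -> Prop) d e u :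
  idl_add (idl_scale d I) (idl_scale e J) u <->
  exists v w, [/\ I v, J w & u = d * v + e * w].
Proof.
split=> [[b [c [[v Iv ->] [w Jw ->] ->]]]|[v [w [Iv Jw ->]]]].
  by exists v, w.
by exists (d * v), (e * w); split; [exists v | exists w |].
Qed.

Lemma idl_cap_pow2 (A : idomainType) (x y z : A) n N i1 i2 i3 u :
  idl_cap (idl_exp (idl_seq [:: y ^+ n - z ^+ n; z ^+ n - x ^+ n]) N)
    (idl_cap (idl_exp (idl_seq [:: x; y]) (i1 * n))
    (idl_cap (idl_exp (idl_seq [:: y; z]) (i2 * n)) (idl_exp (idl_seq [:: x; z]) (i3 * n)))) u
  <-> fermat_cap x y z n N i1 i2 i3 u.
Proof.
split=> [[/idl_exp_seq2 H1 [/idl_exp_seq2 H2 [/idl_exp_seq2 H3 /idl_exp_seq2 H4]]]|[H1 H2 H3 H4]].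
  by split.
by do ?split; apply/idl_exp_seq2.
Qed.

Theorem theorem3p7 (n k : nat) (K : fieldType) (hn : (3 <= n)%N) (hk : (1 <= k)%N)
    (hroots : exists s : seq K,
        [/\ size s = n, uniq s & all (fun w => n.-unity_root w) s]) :
  let x := px K in let y := py K in let z := pz K in
  let f := pf K n in let g := pg K n in let h := ph K n in
  (* existence of the S_j: every admissible choice of S_1, ..., S_{j-1} extends *)
  (forall j, (4 <= j <= 3 * k)%N ->
     forall S : Sfamily K n k, S_admissible (j - 1) S ->
     exists s, S_allowed S j s)
  /\
  (forall S : Sfamily K n k, S_admissible (3 * k) S ->
   forall j i r : nat, (1 <= j <= 3 * k)%N -> j = (3 * i + r)%N ->
     (1 <= r <= 3)%N ->
   [/\ (* (1) *)
       idl_eq (idl_minors (Xmx S j))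
         (by3 r
           (idl_add (idl_scale h (idl_minors (Xmx S (j - 1))))
              (idl_scale (f ^+ ((k - 1 - i) * (n - 3) + 2 * i + 1)
                          * g ^+ ((i + 1) * (n - 2) - 1) * x ^+ (i * n + 1))
                 (idl_exp (idl_seq [:: x; y]) (n - 1))))
           (idl_add (idl_scale f (idl_minors (Xmx S (j - 1))))
              (idl_scale (g ^+ ((k - 1 - i) * (n - 3) + 2 * i + 1)
                          * h ^+ ((i + 1) * (n - 2)) * y ^+ (i * n + 1))
                 (idl_exp (idl_seq [:: y; z]) (n - 1))))
           (idl_add (idl_scale g (idl_minors (Xmx S (j - 1))))
              (idl_scale (f ^+ ((i + 1) * (n - 2))
                          * h ^+ ((k - 1 - i) * (n - 3) + 2 * i + 2)
                          * z ^+ (i * n + 1))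
                 (idl_exp (idl_seq [:: x; z]) (n - 1))))),
       (* (2) *)
       min_graded_free_res (F1shifts n k j i r) (F0shifts n k j i r)
         (Xmx S j) (idl_minors (Xmx S j))
     & (* (3) *)
       idl_eq (idl_minors (Xmx S j))
         (by3 r
           (idl_cap (idl_exp (idl_seq [:: f; g]) (k * (n - 3) + j))
           (idl_cap (idl_exp (idl_seq [:: x; y]) ((i + 1) * n))
           (idl_cap (idl_exp (idl_seq [:: y; z]) (i * n))
                    (idl_exp (idl_seq [:: x; z]) (i * n)))))
           (idl_cap (idl_exp (idl_seq [:: f; g]) (k * (n - 3) + j))
           (idl_cap (idl_exp (idl_seq [:: x; y]) ((i + 1) * n))
           (idl_cap (idl_exp (idl_seq [:: y; z]) ((i + 1) * n))
                    (idl_exp (idl_seq [:: x; z]) (i * n)))))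
           (idl_cap (idl_exp (idl_seq [:: f; g]) (k * (n - 3) + j))
           (idl_cap (idl_exp (idl_seq [:: x; y]) ((i + 1) * n))
           (idl_cap (idl_exp (idl_seq [:: y; z]) ((i + 1) * n))
                    (idl_exp (idl_seq [:: x; z]) ((i + 1) * n))))))]).
Proof.
move=> x y z f g h; split=> [j jk S Sm|S Sm j i r]; first exact: S_exists.
case: j => [//|j] /andP[_ lejk] jE r13.
have r3 : (r <= 3)%N by case/andP: r13.
split.
- move=> u; apply: iff_trans (Xmx_recursion hn hk u Sm lejk lejk jE r13) _.
  rewrite subn1 /= /Fspec.
  move: r13 {jE r3}; case: r => [//|[|[|[|//]]]] _ /=;
    apply: iff_sym; apply: iff_trans (idl_add_scale _ _ _ _ _) _; rewrite (subn1 n) (addn1 (i * n)).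
  + by split=> -[v [w [Hv Hw ->]]]; exists v, w; split=> //; apply/idl_exp_seq2.
  + by split=> -[v [w [Hv Hw ->]]]; exists v, w; split=> //; apply/idl_exp_seq2.
  (* For r = 3 the rotation produces (z,x) and h before f, while the statement has (x,z) and f
     before h. *)
  + split=> -[v [w [Hv Hw ->]]]; exists v, w; split=> //.
    * by apply/pow2C/idl_exp_seq2.
    * by rewrite [in RHS](mulrC (ph K n ^+ _)).
    * by apply/idl_exp_seq2/pow2C.
    * by rewrite [in LHS](mulrC (ph K n ^+ _)).
- exact: (Xmx_resolution hn hk Sm lejk lejk jE r3).
- have [_ HC _] := Xmx_invariant hn hk Sm lejk lejk.
  move=> u; apply: iff_trans (HC u) _; rewrite jE.
  move: r13 {jE r3}; case: r => [//|[|[|[|//]]]] _; apply: iff_sym;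
    apply: iff_trans (idl_cap_pow2 _ _ _ _ _ _ _ _ _) _.
  + have -> : ((3 * i + 1 + 2) %/ 3 = i + 1)%N by clear; lia.
    have -> : ((3 * i + 1 + 1) %/ 3 = i)%N by clear; lia.
    by have -> : ((3 * i + 1) %/ 3 = i)%N by clear; lia.
  + have -> : ((3 * i + 2 + 2) %/ 3 = i + 1)%N by clear; lia.
    have -> : ((3 * i + 2 + 1) %/ 3 = i + 1)%N by clear; lia.
    by have -> : ((3 * i + 2) %/ 3 = i)%N by clear; lia.
  + have -> : ((3 * i + 3 + 2) %/ 3 = i + 1)%N by clear; lia.
    have -> : ((3 * i + 3 + 1) %/ 3 = i + 1)%N by clear; lia.
    by have -> : ((3 * i + 3) %/ 3 = i + 1)%N by clear; lia.
Qed.
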